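(* Let $\epsilon_0>0$, $\alpha>0$, and run $\mathrm{PMWG}(X,F,\epsilon_0,0,\alpha,n)$, so that its noise function is $\xi_t=\frac{\alpha^2n^{1/2}}{162\log(Nn)}\epsilon_0t^{1/2}$; write $\Delta_t=1/t$. Then this algorithm is $(\epsilon,0)$-differentially private for $$\epsilon=\Big(1+\frac{81}{2\alpha^2}\log N\Big)\xi_n\Delta_n+\frac{81}{2\alpha^2}\sum_{t=n+1}^\infty\Big(\frac{\log N}{t}+\frac{\log(t-1)}{t}+\log\frac{t}{t-1}\Big)\xi_t\Delta_t .$$
   Context: Data universe $[N]$. A database of size $t$ is a histogram $x\in\Delta([N])\subseteq\mathbb R^N$ with $x^i=n_i/t$, $n_i\in\mathbb N$, $\sum_i n_i=t$; same-size databases are neighboring if they differ in one entry. A linear query is $f\in[0,1]^N$ with $f(x)=\langle f,x\rangle$. A database stream $X=\{x_t\}_{t\ge n}$ has $x_t$ of size $t$, $x_{t+1}$ obtained from $x_t$ by adding one entry; streams $X,X'$ are neighboring if for some $t\ge n$, $x_\tau=x'_\tau$ for $n\le\tau<t$ and $x_\tau,x'_\tau$ neighboring for $\tau\ge t$. A query stream $F=\{\{f_{t,j}\}_{j=1}^{\ell_t}\}_{t\ge n}$ of linear queries, $f_{t,j}$ arriving when the database has size $t$, may be chosen adaptively. An algorithm is $(\epsilon,0)$-differentially private if for all neighboring streams and every set $S$ of output transcripts, $\Pr[\mathcal A(X)\in S]\le e^\epsilon\Pr[\mathcal A(X')\in S]$. $\mathrm{Lap}(b)$ has density $\frac1{2b}e^{-|z|/b}$.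 Subroutines (threshold $T$, noise function $\xi$, on the database stream). NATG: when started it draws $\eta\sim\mathrm{Lap}(2)$; on each subsequent query $g$ arriving at time $t$ it draws fresh $\nu\sim\mathrm{Lap}(4/\xi_t)$; if $g(x_t)+\nu\ge T+\eta/\xi_t$ it outputs $g(x_t)+Z$, $Z\sim\mathrm{Lap}(8/\xi_t)$ fresh, and halts; otherwise outputs $\bot$. NSG: processes queries in order; whenever a query arrives and no NATG instance is running, it starts a fresh NATG instance with the same $T,\xi$; it outputs the running instance's answer. $\mathrm{PMWG}(X,F,\epsilon_0,0,\alpha,n)$ with noise function $\xi$: run NSG with $T=2\alpha/3$ and noise $\xi$. Maintain a public histogram $y$, initially $y^i=1/N$, and a hard-query count $H=0$; let $b_t=\frac{\log N}{t}+\frac{\log(t-1)}{t}+\log\frac{t}{t-1}$. On query $f=f_{t,j}$: (1) if the previous query arrived at time $t'<t$, set $y^i\leftarrow\frac{t'}{t}y^i+\frac{t-t'}{t}\cdot\frac1N$; (2) submit to NSG the queries $g_1(x)=f(x)-f(y)$ and $g_2(x)=f(y)-f(x)$, getting $a_1,a_2\in\mathbb R\cup\{\bot\}$; (3) if $a_1=a_2=\bot$, output $f(y)$; (4) otherwise set $H\leftarrow H+1$; if $H>\frac{36}{\alpha^2}(\log N+\sum_{\tau=n+1}^t b_\tau)$ halt with output $\bot$; else output $a=f(y)+a_1$ if $a_1\in\mathbb R$ and $a=f(y)-a_2$ otherwise; let $r=f$ if $a<f(y)$ and $r=1-f$ otherwise, and update $y^i\leftarrow y^i e^{-\alpha r^i/6}/\sum_{i'}y^{i'}e^{-\alpha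 r^{i'}/6}$. *)

(* Defs.v *)
From HB Require Import structures.
From mathcomp Require Import all_boot all_order all_algebra.
From mathcomp Require Import all_classical all_reals all_analysis.

Set Implicit Arguments.
Unset Strict Implicit.
Unset Printing Implicit Defensive.

Import Order.TTheory GRing.Theory Num.Theory.
Import numFieldNormedType.Exports.

Local Open Scope classical_set_scope.
Local Open Scope ring_scope.

Section databases.
Context {R : realType} {N : nat}.
Implicit Types x f : 'rV[R]_N.

Definition is_database (t : nat) x : Prop :=
  exists2 c : 'I_N -> nat, (\sum_i c i = t)%N &
    forall i, x ord0 i = (c i)%:R / t%:R.

(* One of the t entries of x, equal to i, is replaced by an entry j <> i. *)
Definition neighboring_databases (t : nat) x x' : Prop :=
  [/\ is_database t x, is_database t x' &
      exists i j : 'I_N, i != j /\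
        x' = x - t%:R^-1 *: delta_mx ord0 i + t%:R^-1 *: delta_mx ord0 j].

(* x_t is [X t]; the values [X t] for t < n are irrelevant. *)
Definition is_database_stream (n : nat) (X : nat -> 'rV[R]_N) : Prop :=
  (forall t, (n <= t)%N -> is_database t (X t)) /\
  (forall t, (n <= t)%N -> exists i : 'I_N,
     t.+1%:R *: X t.+1 = t%:R *: X t + delta_mx ord0 i).

Definition neighboring_streams (n : nat) (X X' : nat -> 'rV[R]_N) : Prop :=
  exists t, [/\ (n <= t)%N,
    forall s, (n <= s < t)%N -> X s = X' s &
    forall s, (t <= s)%N -> neighboring_databases s (X s) (X' s)].

Definition is_linear_query f : Prop := forall i, 0 <= f ord0 i <= 1.

Definition qeval f x : R := \sum_i f ord0 i * x ord0 i.

End databases.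

Section transcripts.
Context {R : realType}.

(* Entry k is the output on the k-th query.  [None] is the output bot; the
   entries after the algorithm has halted or the query stream has ended are
   [None] as well. *)
Definition transcript := nat -> option R.

Definition transcript_cylinders : set (set transcript) :=
  [set A | exists (k : nat) (B : set R), measurable B /\
     A = [set tau : transcript | exists2 r, tau k = Some r & B r]].

Definition transcript_measurable : set (set transcript) :=
  <<s transcript_cylinders >>.

End transcripts.
Arguments transcript : clear implicits.

(* An adaptively chosen query stream, its queries f_{t,j} being listed in order
   of arrival: after the outputs h, the next query is f and arrives at time t if
   [F h = Some (t, f)], and no query is left if [F h = None]. *)
Definition query_strategy (R : realType) (N : nat) :=
  seq (option R) -> option (nat * 'rV[R]_N).

Section query_streams.
Context {R : realType} {N : nat}.

(* The fourth condition says that every l_t is finite; the last one is the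
   measurability of the next query as a function of the past outputs. *)
Definition is_query_stream (n : nat) (F : query_strategy R N) : Prop :=
  [/\ forall h t f, F h = Some (t, f) -> (n <= t)%N,
      forall h t f, F h = Some (t, f) -> is_linear_query f,
      forall h o t f t' f', F h = Some (t, f) ->
        F (rcons h o) = Some (t', f') -> (t <= t')%N,
      forall (tau : transcript R) t, exists K, forall k s f, (K <= k)%N ->
        F (mkseq tau k) = Some (s, f) -> (t < s)%N &
      forall k t (i : 'I_N) (B : set R), measurable B ->
        transcript_measurable [set tau : transcript R |
          exists2 f, F (mkseq tau k) = Some (t, f) & B (f ord0 i)]].

End query_streams.

(* The random draws of the algorithm.  [k] is the index of the query in the
   query stream, [t] its arrival time, and the boolean tells whether g_1 (false)
   or g_2 (true) is being submitted.  [Eta k b] is the draw of the NATG instance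
   started, if any, on the arrival of that submission; [Nu] and [Zeta] are the
   draws nu and Z for that submission. *)
Inductive draw : Type :=
| Eta of nat & bool
| Nu of nat & nat & bool
| Zeta of nat & nat & bool.

Definition draw_scale (R : realType) (xi : nat -> R) (e : draw) : R :=
  match e with
  | Eta _ _ => 2
  | Nu t _ _ => 4 / xi t
  | Zeta t _ _ => 8 / xi t
  end.

(* Draws attached to times before n are never used. *)
Definition draw_used (n : nat) (e : draw) : bool :=
  match e with
  | Eta _ _ => true
  | Nu t _ _ | Zeta t _ _ => (n <= t)%N
  end.

Section noise.
Context {R : realType}.

Definition laplace_pdf (b z : R) : R := (2 * b)^-1 * expR (- `|z| / b).

Context {d : measure_display} {Omega : measurableType d}
  (P : probability Omega R).

Definition laplace_distributed (X : {RV P >-> R}) (b : R) : Prop :=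
  forall A : set R, measurable A ->
    distribution P X A = (\int[lebesgue_measure]_(z in A) (laplace_pdf b z)%:E)%E.

Definition mutually_independent (I : Type) (X : I -> {RV P >-> R}) : Prop :=
  forall (m : nat) (e : 'I_m -> I), injective e ->
  forall B : 'I_m -> set R, (forall j, measurable (B j)) ->
    P (\bigcap_j (X (e j) @^-1` B j)) =
    (\prod_(j < m) P (X (e j) @^-1` B j))%E.

Definition is_laplace_noise (n : nat) (xi : nat -> R)
    (W : draw -> {RV P >-> R}) : Prop :=
  mutually_independent W /\
  forall e, draw_used n e -> laplace_distributed (W e) (draw_scale xi e).

End noise.

Section pmwg.
Context {R : realType} {N : nat}.
Implicit Types (x y f : 'rV[R]_N) (g : 'rV[R]_N -> R) (w : draw -> R).

(* One query to a running NATG instance with initial draw [eta]; [xi] is the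
   value xi_t of the noise function.  The instance halts iff the answer is not
   [None]. *)
Definition natg (T xi eta nu z : R) g x : option R :=
  if T + eta / xi <= g x + nu then Some (g x + z) else None.

(* The state of NSG is the draw eta of the running NATG instance, or [None] if
   no instance is running. *)
Definition nsg (T : R) (xi : nat -> R) w (k t : nat) (b : bool)
    (running : option R) g x : option R * option R :=
  let eta := odflt (w (Eta k b)) running in
  let a := natg T (xi t) eta (w (Nu t k b)) (w (Zeta t k b)) g x in
  (a, if a is Some _ then None else Some eta).

Definition bt (t : nat) : R :=
  ln N%:R / t%:R + ln t.-1%:R / t%:R + ln (t%:R / t.-1%:R).

Definition hard_query_bound (n : nat) (alpha : R) (t : nat) : R :=
  36 / alpha ^+ 2 * (ln N%:R + \sum_(n.+1 <= s < t.+1) bt s).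

Definition mw_update (alpha : R) y (r : 'rV[R]_N) : 'rV[R]_N :=
  let u i := y ord0 i * expR (- alpha * r ord0 i / 6) in
  \row_i (u i / \sum_i' u i').

(* [last] is the arrival time of the previous query, if any. *)
Definition mix_uniform (last : option nat) (t : nat) y : 'rV[R]_N :=
  if last is Some t' then
    if (t' < t)%N then
      \row_i (t'%:R / t%:R * y ord0 i + (t - t')%:R / t%:R * N%:R^-1)
    else y
  else y.

Record pmwg_state := PmwgState {
  st_done : bool;             (* PMWG has halted or the queries have ended *)
  st_last : option nat;       (* arrival time of the previous query *)
  st_hist : 'rV[R]_N;         (* public histogram y *)
  st_hard : nat;              (* hard-query count H *)
  st_nsg : option R           (* state of NSG *)
}.

Definition pmwg_init : pmwg_state :=
  PmwgState false None (const_mx N%:R^-1) 0 None.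

(* The processing of the k-th query f, arriving at time t. *)
Definition pmwg_query (n : nat) (alpha : R) (xi : nat -> R) w (k t : nat) f x
    (s : pmwg_state) : option R * pmwg_state :=
  let T := 2 * alpha / 3 in
  let y := mix_uniform (st_last s) t (st_hist s) in
  let fy := qeval f y in
  let: (a1, run1) :=
    nsg T xi w k t false (st_nsg s) (fun z => qeval f z - fy) x in
  let: (a2, run2) :=
    nsg T xi w k t true run1 (fun z => fy - qeval f z) x in
  let answer :=
    match a1, a2 with
    | Some v, _ => Some (fy + v)
    | None, Some v => Some (fy - v)
    | None, None => None
    end in
  if answer is Some a then
    let H := (st_hard s).+1 in
    if H%:R > hard_query_bound n alpha t
    then (None, PmwgState true (Some t) y H run2)
    else
      let r := if a < fy then f else const_mx 1 - f in
      (Some a, PmwgState false (Some t) (mw_update alpha y r) H run2)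
  else (Some fy, PmwgState false (Some t) y (st_hard s) run2).

Definition pmwg_step (n : nat) (alpha : R) (xi : nat -> R) w
    (F : query_strategy R N) (X : nat -> 'rV[R]_N)
    (hs : seq (option R) * pmwg_state) : seq (option R) * pmwg_state :=
  let: (h, s) := hs in
  if st_done s then (rcons h None, s) else
  if F h is Some (t, f) then
    let: (o, s') := pmwg_query n alpha xi w (size h) t f (X t) s in
    (rcons h o, s')
  else (rcons h None,
        PmwgState true (st_last s) (st_hist s) (st_hard s) (st_nsg s)).

Definition pmwg (n : nat) (alpha : R) (xi : nat -> R) w
    (F : query_strategy R N) (X : nat -> 'rV[R]_N) : transcript R :=
  fun k => nth None (iter k.+1 (pmwg_step n alpha xi w F X)
                       ([::], pmwg_init)).1 k.

End pmwg.
Arguments bt {R} N t.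

(* (eps,0)-differential privacy of a randomized algorithm mapping database
   streams, started at size n, to transcripts; [A X] is its transcript as a
   function of the sample point. *)
Definition differentially_private (R : realType) (N n : nat)
    (d : measure_display) (Omega : measurableType d) (P : probability Omega R)
    (A : (nat -> 'rV[R]_N) -> Omega -> transcript R) (eps : R) : Prop :=
  forall X X' : nat -> 'rV[R]_N,
    is_database_stream n X -> is_database_stream n X' ->
    neighboring_streams n X X' ->
  forall S : set (transcript R), transcript_measurable S ->
    (P (A X @^-1` S) <= (expR eps)%:E * P (A X' @^-1` S))%E.

Definition pmwg_noise (R : realType) (N n : nat) (alpha eps0 : R) (t : nat) : R :=
  alpha ^+ 2 * Num.sqrt n%:R / (162 * ln (N * n)%:R) * eps0 * Num.sqrt t%:R.

(* Main.v *)
Require Import Defs.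
From HB Require Import structures.
From mathcomp Require Import all_boot all_order all_algebra.
From mathcomp Require Import all_classical all_reals all_analysis.
From mathcomp Require Import measurable_realfun ring lra.

(** The noise is moved so that an execution on one stream becomes an execution on
its neighbor with the same transcript.  Write s_t = xi_t / t, which is
nonincreasing, and let an NATG instance be started at time t_0 and halt at time
t_1.  Shifting eta by s_(t_0) keeps all answers bot (cost s_(t_0) / 2), shifting
the last nu by s_(t_0) / xi_(t_1) + 1 / t_1 keeps the positive answer (cost
(s_(t_0) + s_(t_1)) / 4), and shifting Z by at most 1 / t_1 keeps its value (cost
s_(t_1) / 8), in total at most 3/4 s_(t_0) + 3/8 s_(t_1).  If both g_1 and g_2 are
answered, the second instance is free: as g_2 = - g_1, a change of the database
that makes one of the two comparisons harder makes the other one easier.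

The instance following a hard query at time t starts at time at least t, so the
hard queries at times tau_1 <= tau_2 <= ... cost at most 9/8 times the sum of the
s_(tau_i), plus 3/4 s_n for the first instance and 1/4 s_n if PMWG halts.  As the
i-th hard query satisfies i <= 36/alpha^2 (log N + sum_(n < tau <= tau_i) b_tau),
summation by parts bounds the sum of the s_(tau_i).

Once the arrival times and the positive answers of the first queries are fixed,
finitely many draws matter, and the shift of each of them depends only on earlier
draws, so that it is a translation given those.  There are countably many such
sequences of times and answers, which yields the bound for events depending on
finitely many outputs; the monotone class theorem gives the rest. *)

Set Implicit Arguments.
Unset Strict Implicit.
Unset Printing Implicit Defensive.

Import Order.TTheory GRing.Theory Num.Theory.
Import numFieldNormedType.Exports.

Local Open Scope classical_set_scope.
Local Open Scope ring_scope.

Lemma measurable_preimage d d' (T : measurableType d) (U : measurableType d')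
    (f : T -> U) (A : set U) :
  measurable_fun [set: T] f -> measurable A -> measurable (f @^-1` A).
Proof. by move=> mf mA; rewrite -[X in measurable X]setTI; exact: mf. Qed.

(** * Translations of Laplace noise *)

Section lebesgue_translation.
Context {R : realType}.
Local Notation mu := (@lebesgue_measure R).

Lemma measurable_addr (c : R) : measurable_fun [set: R] (fun z : R => z + c).
Proof. exact: measurable_funD. Qed.

Lemma lebesgue_measure_translation (c : R) (A : set R) : measurable A ->
  pushforward mu (+%R^~ c : _ -> measurableTypeR R) A = mu A.
Proof.
move=> mA; apply/esym/lebesgue_measure_unique => //=; first exact: measurable_addr.
move=> mt _ [[a b]] _ <-; rewrite /pushforward.
have -> : +%R^~ c @^-1` `]a, b]%classic = `]a - c, b - c]%classic.
  by apply/seteqP; split => x /=; rewrite !in_itv/= ltrBlDr lerBrDr.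
rewrite !lebesgue_measure_itv/= !lte_fin ltrD2r; case: ifP => // _.
by rewrite -!EFinB; congr EFin; ring.
Qed.

Lemma ge0_integral_translation (c : R) (A : set R) (f : R -> \bar R) :
  measurable A -> measurable_fun [set: R] f -> (forall z, 0 <= f z)%E ->
  (\int[mu]_(z in (fun z => (z - c)%R) @^-1` A) f z =
   \int[mu]_(z in A) f (z + c)%R)%E.
Proof.
move=> mA mf f0; have mA' := measurable_preimage (measurable_addr (- c)) mA.
pose shift : R -> measurableTypeR R := +%R^~ c.
have mshift : measurable_fun [set: measurableTypeR R] shift by exact: measurable_addr.
have -> : (\int[mu]_(z in A) f (z + c)%R =
    \int[mu]_(z in shift @^-1` ((fun z => (z - c)%R) @^-1` A)) (f \o shift) z)%E.
  by congr integral; apply/seteqP; split => x /=; rewrite /shift addrK.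
rewrite -(ge0_integral_pushforward mshift)//; last exact: measurable_funTS.
by apply: eq_measure_integral => B mB _; exact/esym/lebesgue_measure_translation.
Qed.

End lebesgue_translation.

Section laplace_shift.
Context {R : realType}.
Local Notation mu := (@lebesgue_measure R).

Lemma measurable_laplace_pdf (b : R) : measurable_fun [set: R] (laplace_pdf b).
Proof.
apply: measurable_funM => //; apply: measurableT_comp => //.
by apply: measurable_funM => //; exact: measurableT_comp.
Qed.

Lemma laplace_pdf_ge0 (b z : R) : 0 < b -> 0 <= laplace_pdf b z.
Proof. by move=> b0; rewrite mulr_ge0 ?expR_ge0// invr_ge0 mulr_ge0// ltW. Qed.

Lemma laplace_pdf_shift (b c z : R) : 0 < b ->
  laplace_pdf b z <= expR (`|c| / b) * laplace_pdf b (z + c).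
Proof.
move=> b0; rewrite /laplace_pdf mulrCA; apply: ler_wpM2l.
  by rewrite invr_ge0 mulr_ge0// ltW.
rewrite -expRD ler_expR -mulrDl ler_pM2r ?invr_gt0//.
by have := ler_normD z c; lra.
Qed.

Context {d : measure_display} {Omega : measurableType d}.
Variables (P : probability Omega R) (X : {RV P >-> R}) (b : R).
Hypotheses (b0 : 0 < b) (X_laplace : laplace_distributed X b).

Lemma laplace_distribution_shift (c : R) (A : set R) : measurable A ->
  (distribution P X A <=
   (expR (`|c| / b))%:E * distribution P X ((fun z : R => (z - c)%R) @^-1` A))%E.
Proof.
move=> mA; have mA' := measurable_preimage (measurable_addr (- c)) mA.
have mpdf := measurable_laplace_pdf b.
have pdf_ge0 z : (0 <= (laplace_pdf b z)%:E)%E by rewrite lee_fin laplace_pdf_ge0.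
have mpdfc : measurable_fun [set: R] (fun z : R => laplace_pdf b (z + c)).
  exact: measurableT_comp mpdf (measurable_addr c).
rewrite !X_laplace// ge0_integral_translation//; last exact/measurable_EFinP.
rewrite -ge0_integralZl//; last by apply: measurable_funTS; exact/measurable_EFinP.
apply: ge0_le_integral => //.
- by apply: measurable_funTS; exact/measurable_EFinP.
- by apply: measurable_funTS; apply/measurable_EFinP; exact: measurable_funM.
- by move=> z _; rewrite -EFinM lee_fin laplace_pdf_shift.
Qed.

Lemma laplace_integral_shift (c : R) (G G' : R -> \bar R) :
  measurable_fun [set: R] G -> measurable_fun [set: R] G' ->
  (forall z, 0 <= G z)%E -> (forall z, G z <= G' (z + c)%R)%E ->
  (\int[distribution P X]_z G z <=
   (expR (`|c| / b))%:E * \int[distribution P X]_z G' z)%E.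
Proof.
move=> mG mG' G0 GG'.
pose shift : {mfun R >-> R} :=
  HB.pack (fun z : R => z - c)
    (isMeasurableFun.Build _ _ _ _ _ (measurable_addr (- c))).
pose k : {nonneg R} := NngNum (expR_ge0 (`|c| / b)).
pose scaled := mscale k (distribution (distribution P X) shift).
have Xscaled : (\int[distribution P X]_z G z <= \int[scaled]_z G z)%E.
  by apply: ge0_le_measure_integral => // A mA; exact: laplace_distribution_shift.
apply: (le_trans Xscaled).
rewrite ge0_integral_mscale//= ge0_integral_distribution//=.
apply: lee_wpmul2l; first by rewrite lee_fin expR_ge0.
apply: ge0_le_integral => //.
- exact: measurableT_comp mG (measurable_addr (- c)).
- by move=> z _ /=; rewrite (le_trans (GG' _))// subrK.
Qed.

End laplace_shift.

(** * Independent families of draws *)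

Section noise_space.
Context {R : realType} {I : eqType}.

Definition coord_cylinders : set (set (I -> R)) :=
  [set A | exists e (B : set R), measurable B /\ A = [set u | B (u e)]].

Definition noise_space := g_sigma_algebraType coord_cylinders.

HB.instance Definition _ := Measurable.on noise_space.

Lemma measurable_cylinder e (B : set R) : measurable B ->
  measurable [set u : noise_space | B (u e)].
Proof. by move=> mB; apply: sub_sigma_algebra; exists e, B. Qed.

Lemma measurable_coord e : measurable_fun [set: noise_space] (fun u => u e).
Proof. by move=> _ B mB; rewrite setTI; exact: measurable_cylinder. Qed.

Lemma measurable_to_noise d (T : measurableType d) (f : T -> noise_space) :
  (forall e, measurable_fun [set: T] (fun x => f x e)) ->
  measurable_fun [set: T] f.
Proof.
move=> mf; apply: (@measurability _ _ T noise_space setT f coord_cylinders) => //.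
by move=> _ [_ [e [B [mB ->]]] <-]; exact: mf.
Qed.

Definition resample (e : I) (x : noise_space * R) : noise_space :=
  [eta x.1 with e |-> x.2].

Lemma resampleE e u z e' :
  resample e (u, z) e' = if e' == e then z else u e'.
Proof. by []. Qed.

Lemma measurable_resample e : measurable_fun [set: _] (resample e).
Proof.
apply: measurable_to_noise => e'; rewrite /resample/=; case: (e' == e).
  exact: measurable_snd.
exact: measurableT_comp (measurable_coord e') measurable_fst.
Qed.

HB.instance Definition _ e := isMeasurableFun.Build _ _ _ _
  (resample e) (measurable_resample e).

Definition box (B : I -> set R) : set noise_space := [set u | forall e, B e (u e)].

Definition boxes : set (set noise_space) :=
  [set A | exists (s : seq I) (B : I -> set R),
    [/\ forall e, measurable (B e), forall e, e \notin s -> B e = setT &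
        A = box B]].

Lemma measurable_box (s : seq I) (B : I -> set R) :
  (forall e, measurable (B e)) -> (forall e, e \notin s -> B e = setT) ->
  measurable (box B).
Proof.
move=> mB Bs; have -> : box B = \bigcap_(e in [set` s]) [set u | B e (u e)].
  apply/seteqP; split => u /= Bu; first by move=> e _; exact: Bu.
  by move=> e; have [/Bu//|/Bs ->] := boolP (e \in s).
by apply: fin_bigcap_measurable => // e _; exact: measurable_cylinder.
Qed.

Lemma measurable_boxesE : @measurable _ noise_space = <<s boxes >>.
Proof.
apply/seteqP; split; last first.
  apply: smallest_sub; first exact: sigma_algebra_measurable.
  by move=> _ [s [B [mB Bs ->]]]; exact: measurable_box Bs.
apply: sub_sigma_algebra2 => _ [e [B [mB ->]]].
exists [:: e], (fun e' => if e' == e then B else setT); split.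
- by move=> e'; case: ifP.
- by move=> e'; rewrite inE => /negbTE ->.
- apply/seteqP; split => u /=; first by move=> Bu e'; case: eqP => // ->.
  by move=> /(_ e); rewrite eqxx.
Qed.

Lemma setI_closed_boxes : setI_closed boxes.
Proof.
move=> _ _ [s [B [mB Bs ->]]] [s' [B' [mB' Bs' ->]]].
exists (s ++ s'), (fun e => B e `&` B' e); split.
- by move=> e; exact: measurableI.
- by move=> e; rewrite mem_cat negb_or => /andP[/Bs -> /Bs' ->]; rewrite setTI.
- apply/seteqP; split => u /=; first by move=> [Bu Bu'] e; split.
  by move=> BB; split=> e; case: (BB e).
Qed.

Context {d : measure_display} {Omega : measurableType d}.
Variables (P : probability Omega R) (W : I -> {RV P >-> R}).
Hypothesis indepW : mutually_independent W.

Definition noise (x : Omega) : noise_space := fun e => W e x.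

Lemma measurable_noise : measurable_fun [set: Omega] noise.
Proof. by apply: measurable_to_noise => e; exact: measurable_funP. Qed.

HB.instance Definition _ := isMeasurableFun.Build _ _ _ _ noise measurable_noise.

Definition law : probability noise_space R := distribution P noise.

Lemma law_box (s : seq I) (B : I -> set R) : (forall e, measurable (B e)) ->
  (forall e, e \notin s -> B e = setT) ->
  law (box B) = (\prod_(e <- undup s) P (W e @^-1` B e))%E.
Proof.
move=> mB Bs; rewrite big_tnth -indepW//; last first.
  by apply/tuple_uniqP; exact: undup_uniq.
congr (P _); apply/seteqP; split => x /= Bx; first by move=> j _; exact: Bx.
move=> e; have [es|/Bs ->//] := boolP (e \in s).
have /tnthP[j ->] : e \in in_tuple (undup s) by rewrite mem_undup.
exact: Bx.
Qed.

Lemma law_box_resample e (s : seq I) (B : I -> set R) :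
  (forall e, measurable (B e)) -> (forall e, e \notin s -> B e = setT) ->
  law (box B) =
  distribution (law \x distribution P (W e))%E (resample e) (box B).
Proof.
move=> mB Bs; pose B' e' := if e' == e then setT else B e'.
have B'e : B' e = setT by rewrite /B' eqxx.
have mB' e' : measurable (B' e') by rewrite /B'; case: ifP.
have sB e' : e' \notin e :: s -> B e' = setT.
  by rewrite inE negb_or => /andP[_ /Bs].
have sB' e' : e' \notin e :: s -> B' e' = setT.
  by rewrite /B'; case: eqP => // _; exact: sB.
have resampleK : resample e @^-1` box B = box B' `*` B e.
  apply/seteqP; split => -[u z] /= Bu; last first.
    move: Bu => [B'u Bz] e'; rewrite resampleE; case: (eqVneq e' e) => [->//|ee'].
    by move: (B'u e'); rewrite /B' (negbTE ee').
  split; last by move: (Bu e); rewrite resampleE eqxx.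
  by move=> e'; move: (Bu e'); rewrite resampleE /B'; case: eqP.
rewrite /distribution /pushforward resampleK.
apply: (etrans _ (esym (product_measure1E _ _ (measurable_box mB' sB') (mB e)))).
transitivity (law (box B') * P (W e @^-1` B e))%E; last by [].
rewrite (law_box mB sB) (law_box mB' sB').
have es : e \in undup (e :: s) by rewrite mem_undup mem_head.
rewrite !(bigD1_seq e es (undup_uniq _))/= B'e.
rewrite preimage_setT probability_setT mul1e muleC; congr (_ * _)%E.
by apply: eq_bigr => e' /negbTE ee'; rewrite /B' ee'.
Qed.

Lemma law_resample e (A : set noise_space) : measurable A ->
  law A = distribution (law \x distribution P (W e))%E (resample e) A.
Proof.
apply: (measure_unique boxes (fun=> setT)).
- exact: measurable_boxesE.
- exact: setI_closed_boxes.
- by move=> _; exists [::], (fun=> setT); split=> //; apply/seteqP; split.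
- by rewrite bigcup_const.
- by move=> _ [s [B [mB Bs ->]]]; exact: law_box_resample Bs.
- by move=> _; apply: (le_lt_trans (probability_le1 _ _)); rewrite ?ltry.
Qed.

Lemma integral_law_resample e (phi : noise_space -> \bar R) :
  measurable_fun [set: noise_space] phi -> (forall u, 0 <= phi u)%E ->
  (\int[law]_u phi u =
   \int[law]_u \int[distribution P (W e)]_z phi (resample e (u, z)))%E.
Proof.
move=> mphi phi0.
transitivity (\int[distribution (law \x distribution P (W e))%E
  (resample e)]_u phi u)%E.
  by apply: eq_measure_integral => A mA _; exact: law_resample.
rewrite ge0_integral_distribution// fubini_tonelli1//=.
exact: measurableT_comp mphi (measurable_resample e).
Qed.

End noise_space.

Section predictable_shift.
Context {R : realType} {I : eqType}.
Local Notation noise_space := (@noise_space R I).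
Implicit Types (es : seq I) (u v : noise_space).

Definition shift_coords es (c : I -> R) u : noise_space :=
  fun e => if e \in es then u e + c e else u e.

Definition agree_off es u v : Prop := forall e, e \notin es -> u e = v e.

(* The list is in the order of the draws: each shift depends on earlier draws only. *)
Fixpoint predictable es (c : noise_space -> I -> R) : Prop :=
  if es is e :: es' then
    (forall u v, agree_off es u v -> c u e = c v e) /\ predictable es' c
  else True.

Lemma predictable_rank (rk : I -> nat) es (c : noise_space -> I -> R) :
  sorted (relpre rk leq) es ->
  (forall u v e, (forall e', (rk e' < rk e)%N -> u e' = v e') -> c u e = c v e) ->
  predictable es c.
Proof.
move=> + c_rk; elim: es => [//|e es IH] /= pes; split; last exact/IH/path_sorted/pes.
move=> u v uv; apply: c_rk => e' rk_e'; apply: uv; apply/negP.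
have rk_trans : transitive (relpre rk leq) by move=> ? ? ?; exact: leq_trans.
have /allP rk_es := order_path_min rk_trans pes.
rewrite inE => /predU1P[e'e|/rk_es /=]; first by rewrite e'e ltnn in rk_e'.
by rewrite leqNgt rk_e'.
Qed.

Context {d : measure_display} {Omega : measurableType d}.
Variables (P : probability Omega R) (W : I -> {RV P >-> R}).

Fixpoint iter_integral es (phi : noise_space -> \bar R) u : \bar R :=
  if es is e :: es' then
    (\int[distribution P (W e)]_z iter_integral es' phi (resample e (u, z)))%E
  else phi u.

Lemma iter_integral_ge0 es phi u : (forall u, 0 <= phi u)%E ->
  (0 <= iter_integral es phi u)%E.
Proof.
move=> phi0; elim: es u => [|e es IH] u //=.
by apply: integral_ge0 => z _; exact: IH.
Qed.

Lemma measurable_iter_integral es phi :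
  measurable_fun [set: noise_space] phi -> (forall u, 0 <= phi u)%E ->
  measurable_fun [set: noise_space] (iter_integral es phi).
Proof.
move=> mphi phi0; elim: es => [//|e es IH] /=.
apply: (measurable_fun_fubini_tonelli_F (iter_integral es phi \o resample e)).
- exact: measurableT_comp IH (measurable_resample e).
- by move=> x; exact: iter_integral_ge0.
Qed.

Lemma measurable_resample_section u e :
  measurable_fun [set: R] (fun z => resample e (u, z)).
Proof. by apply: measurable_to_noise => e'; rewrite /resample/=; case: eqP. Qed.

Lemma measurable_shift_coord e (c : R) :
  measurable_fun [set: noise_space] (fun u => resample e (u, u e + c)).
Proof.
apply: measurableT_comp (measurable_resample e) _.
apply: measurable_fun_pair => //; apply: measurable_funD => //.
exact: measurable_coord.
Qed.

Lemma measurable_iter_integral_resample es phi u e :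
  measurable_fun [set: noise_space] phi -> (forall u, 0 <= phi u)%E ->
  measurable_fun [set: R] (fun z => iter_integral es phi (resample e (u, z))).
Proof.
move=> mphi phi0; apply: measurableT_comp (measurable_resample_section u e).
exact: measurable_iter_integral.
Qed.

Lemma iter_integral_shift_coord es phi e (c : R) u : e \notin es ->
  iter_integral es (fun v => phi (resample e (v, v e + c))) u =
  iter_integral es phi (resample e (u, u e + c)).
Proof.
elim: es u => [//|e1 es IH] u; rewrite inE negb_or => /andP[ee1 ees] /=.
apply: eq_integral => z _; rewrite IH//; congr iter_integral.
apply/funext => e'; rewrite /resample/= (negbTE ee1).
by case: (eqVneq e' e) => [->|//]; rewrite (negbTE ee1).
Qed.

Variable b : I -> R.

Lemma iter_integral_le_shift es phi psi c (C : R) u : uniq es ->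
  (forall e, e \in es -> 0 < b e /\ laplace_distributed (W e) (b e)) ->
  measurable_fun [set: noise_space] phi -> (forall u, 0 <= phi u)%E ->
  measurable_fun [set: noise_space] psi -> (forall u, 0 <= psi u)%E ->
  predictable es c ->
  (forall v, agree_off es v u ->
     (phi v <= (expR (C - \sum_(e <- es) `|c v e| / b e))%:E *
               psi (shift_coords es (c v) v))%E) ->
  (iter_integral es phi u <= (expR C)%:E * iter_integral es psi u)%E.
Proof.
move=> + + mphi phi0; elim: es psi C u => [|e es IH] psi C u /=.
  by move=> _ _ _ _ _ /(_ u); rewrite big_nil subr0; exact.
move=> /andP[ees ues] laplace mpsi psi0 [ce c_es] phi_le.
have [b0 We_laplace] := laplace e (mem_head _ _).
pose cost := `|c u e| / b e.
have expC0 : (0 <= (expR (C - cost))%:E)%E by rewrite lee_fin expR_ge0.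
have -> : expR C = expR cost * expR (C - cost) by rewrite -expRD addrC subrK.
rewrite EFinM -muleA -ge0_integralZl//; first last.
- by move=> z _; exact: iter_integral_ge0.
- exact: measurable_iter_integral_resample.
apply: laplace_integral_shift => //.
- exact: measurable_iter_integral_resample.
- by apply: emeasurable_funM => //; exact: measurable_iter_integral_resample.
- by move=> z; exact: iter_integral_ge0.
move=> z; pose psi' v := psi (resample e (v, v e + c u e)).
have mpsi' : measurable_fun [set: noise_space] psi'.
  exact: measurableT_comp mpsi (measurable_shift_coord e (c u e)).
have -> : resample e (u, z + c u e) =
    resample e (resample e (u, z), resample e (u, z) e + c u e).
  by apply/funext => e'; rewrite /resample/= eqxx; case: eqP.
rewrite -iter_integral_shift_coord//.
apply: IH => //; first by move=> e' e'es; apply: laplace; rewrite inE e'es orbT.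
move=> v vu.
have vu' : agree_off (e :: es) v u.
  move=> e'; rewrite inE negb_or => /andP[/negbTE e'e /vu ->].
  by rewrite resampleE e'e.
apply: le_trans (phi_le v vu') _.
rewrite big_cons (ce _ _ vu') opprD addrA -/cost le_eqVlt; apply/orP; left; apply/eqP.
congr (_ * psi _)%E; apply/funext => e'; rewrite /shift_coords /resample/= inE.
by case: (eqVneq e' e) => [->|//]; rewrite (negbTE ees) (ce _ _ vu').
Qed.

Hypothesis indepW : mutually_independent W.

Lemma integral_iter_integral es phi :
  measurable_fun [set: noise_space] phi -> (forall u, 0 <= phi u)%E ->
  (\int[law W]_u iter_integral es phi u = \int[law W]_u phi u)%E.
Proof.
move=> mphi phi0; elim: es => [//|e es IH] /=; rewrite -IH.
rewrite [in RHS](integral_law_resample indepW e)//.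
  exact: measurable_iter_integral.
by move=> u; exact: iter_integral_ge0.
Qed.

Lemma law_le_shift es c (A B : set noise_space) (C : R) : uniq es ->
  (forall e, e \in es -> 0 < b e /\ laplace_distributed (W e) (b e)) ->
  measurable A -> measurable B -> predictable es c ->
  (forall u, A u -> \sum_(e <- es) `|c u e| / b e <= C) ->
  (forall u, A u -> B (shift_coords es (c u) u)) ->
  (law W A <= (expR C)%:E * law W B)%E.
Proof.
move=> ues laplace mA mB c_es cost_le AB.
pose ind (D : set noise_space) u : \bar R := (\1_D u)%:E.
have ind_ge0 D u : (0 <= ind D u)%E by rewrite lee_fin.
have mind D : measurable D -> measurable_fun [set: noise_space] (ind D).
  by move=> mD; apply/measurable_EFinP; exact: measurable_indic.
have miter D : measurable D ->
    measurable_fun [set: noise_space] (iter_integral es (ind D)).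
  by move=> mD; apply: measurable_iter_integral => //; exact: mind.
have lawE D : measurable D -> law W D = (\int[law W]_u iter_integral es (ind D) u)%E.
  by move=> mD; rewrite integral_iter_integral ?integral_indic ?setIT//; exact: mind.
rewrite !lawE// -ge0_integralZl//; first last.
- by move=> u _; exact: iter_integral_ge0.
- exact: miter.
apply: ge0_le_integral => //.
- by move=> u _; exact: iter_integral_ge0.
- exact: miter.
- by apply: emeasurable_funM => //; exact: miter.
move=> u _; apply: iter_integral_le_shift c_es _ => //; [exact: mind|exact: mind|].
move=> v _; rewrite /ind !indicE.
have [/set_mem Av|_] := boolP (v \in A); last by rewrite mule_ge0// lee_fin ?expR_ge0.
rewrite (mem_set (AB _ Av)) mule1 lee_fin -expR0 ler_expR subr_ge0.
exact: cost_le.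
Qed.

End predictable_shift.

(** * Measurability and comparison of measures *)

Section discrete_maps.
Context {d : measure_display} {T : measurableType d}.

Definition measurable_fibers (I : Type) (f : T -> I) : Prop :=
  forall i, measurable (f @^-1` [set i]).

Lemma measurable_selection (I : countType) (f : T -> I) (A : I -> set T) :
  measurable_fibers f -> (forall i, measurable (A i)) ->
  measurable [set x | A (f x) x].
Proof.
move=> mf mA; rewrite (_ : [set x | _] = \bigcup_n
    if unpickle n is Some i then f @^-1` [set i] `&` A i else set0).
  by apply: bigcup_measurable => n _; case: unpickle => // i; exact: measurableI.
apply/seteqP; split => x /=; first by exists (pickle (f x)); rewrite // pickleK.
by case=> n _; case: unpickle => // i [/= <-].
Qed.

Lemma measurable_fun_selection (I : countType) d' (U : measurableType d')
    (f : T -> I) (g : I -> T -> U) :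
  measurable_fibers f -> (forall i, measurable_fun [set: T] (g i)) ->
  measurable_fun [set: T] (fun x => g (f x) x).
Proof.
move=> mf mg _ B mB; rewrite setTI.
apply: (measurable_selection (A := fun i => g i @^-1` B)) => // i.
exact: measurable_preimage mB.
Qed.

Lemma measurable_prop (p : Prop) : measurable [set _ : T | p].
Proof.
have [pT|pF] := pselect p.
  by rewrite (_ : [set _ | _] = setT)//; apply/seteqP; split.
by rewrite (_ : [set _ | _] = set0)//; apply/seteqP; split.
Qed.

Lemma measurable_fibers_comp (I : countType) (J : Type) (f : T -> I) (h : I -> J) :
  measurable_fibers f -> measurable_fibers (h \o f).
Proof.
move=> mf j; apply: (measurable_selection (A := fun i => [set _ | h i = j])) => // i.
exact: measurable_prop.
Qed.

Lemma measurable_fibers_pair (I J : Type) (f : T -> I) (g : T -> J) :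
  measurable_fibers f -> measurable_fibers g ->
  measurable_fibers (fun x => (f x, g x)).
Proof.
move=> mf mg [i j]; rewrite (_ : _ @^-1` _ = f @^-1` [set i] `&` g @^-1` [set j]).
  exact: measurableI.
by apply/seteqP; split => x /= => [[-> ->]|[-> ->]].
Qed.

Lemma measurable_fibers_bool (f : T -> bool) :
  measurable_fun [set: T] f -> measurable_fibers f.
Proof. by move=> mf i; exact: measurable_preimage. Qed.

Lemma measure_le_fibers (R : realType) (I : countType) (m : {measure set T -> \bar R})
    (f g : T -> I) (A B : set T) (k : R) : 0 <= k ->
  measurable A -> measurable B -> measurable_fibers f -> measurable_fibers g ->
  (forall i, f @^-1` [set i] `&` A !=set0 ->
     (m (f @^-1` [set i] `&` A) <= k%:E * m (g @^-1` [set i] `&` B))%E) ->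
  (m A <= k%:E * m B)%E.
Proof.
move=> k0 mA mB mf mg le_fiber.
have fiberE (h : T -> I) i :
    h @^-1` [set i] = (pickle \o h) @^-1` [set pickle i].
  by apply/seteqP; split => x /= => [->//|/(pcan_inj pickleK)].
have mpiece h D n : measurable_fibers h -> measurable D ->
    measurable ((pickle \o h) @^-1` [set n] `&` D).
  move=> mh mD; apply: measurableI => //.
  exact: (measurable_fibers_comp pickle mh).
have sum_pieces (h : T -> I) D : measurable_fibers h -> measurable D ->
    m D = (\sum_(n <oo) m ((pickle \o h) @^-1` [set n] `&` D))%E.
  move=> mh mD; rewrite -[in LHS](setTI D).
  rewrite (_ : setT = \bigcup_n (pickle \o h) @^-1` [set n]).
    rewrite setI_bigcupl measure_bigcup//; first last.
    - apply/trivIsetP => n n' _ _ /negbTE nn'; apply/seteqP; split=> // x /=.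
      by move=> [[-> _] [/eqP]]; rewrite nn'.
    - by move=> n _; exact: mpiece.
    by apply: eq_eseriesl => n; rewrite in_setT.
  by apply/seteqP; split => x // _; exists (pickle (h x)).
rewrite (sum_pieces f A)// (sum_pieces g B)// -nneseriesZl//.
apply: lee_nneseries => // n _.
have [->|/set0P[x [/= <- Ax]]] := eqVneq ((pickle \o f) @^-1` [set n] `&` A) set0.
  by rewrite measure0 mule_ge0.
by rewrite -!fiberE; apply: le_fiber; exists x.
Qed.

End discrete_maps.

Lemma measurable_fibers_precomp d d' (S : measurableType d) (T : measurableType d')
    (I : Type) (f : T -> I) (phi : S -> T) :
  measurable_fun [set: S] phi -> measurable_fibers f -> measurable_fibers (f \o phi).
Proof.
by move=> mphi mf i; rewrite comp_preimage; exact: measurable_preimage mphi _.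
Qed.

Section measurable_option.
Context {d : measure_display} {T : measurableType d}.

Definition some_images : set (set (option T)) := [set Some @` B | B in measurable].

HB.instance Definition _ :=
  Measurable.copy (option T) (g_sigma_algebraType some_images).

Lemma measurable_image_some (B : set T) :
  measurable B -> measurable (Some @` B).
Proof. by move=> mB; apply: sub_sigma_algebra; exists B. Qed.

Lemma measurable_set1_none : measurable [set None : option T].
Proof.
rewrite (_ : [set _] = ~` (Some @` setT)).
  by apply: measurableC; exact: measurable_image_some.
apply/seteqP; split => -[x|] //=; first by move=> _ [].
by case; exists x.
Qed.

Lemma measurable_to_option d' (S : measurableType d') (o : S -> option T) :
  (forall B, measurable B -> measurable (o @^-1` (Some @` B))) ->
  measurable_fun [set: S] o.
Proof.
move=> mo; apply: (@measurability _ _ S (option T) setT o some_images) => //.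
by move=> _ [_ [B mB <-] <-]; rewrite setTI; exact: mo.
Qed.

Lemma measurable_some : measurable_fun [set: T] (@Some T).
Proof.
apply: measurable_to_option => B mB; rewrite (_ : _ @^-1` _ = B)//.
by apply/seteqP; split => x /= => [[y By [<-]]|Bx]//; exists x.
Qed.

Lemma measurable_oapp d' (U : measurableType d') (f : T -> U) (u : U) :
  measurable_fun [set: T] f -> measurable_fun [set: option T] (oapp f u).
Proof.
move=> mf _ B mB; rewrite setTI.
rewrite (_ : _ @^-1` _ = Some @` (f @^-1` B) `|` ([set None] `&` [set _ | B u])).
  apply: measurableU.
    by apply: measurable_image_some; exact: measurable_preimage mB.
  by apply: measurableI; [exact: measurable_set1_none|exact: measurable_prop].
apply/seteqP; split => -[x|] /=.
- by left; exists x.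
- by right.
- by case=> [[y By [<-]]|[]].
- by case=> [[]|[]].
Qed.

Lemma measurable_odflt d' (S : measurableType d') (g : S -> T) (o : S -> option T) :
  measurable_fun [set: S] g -> measurable_fun [set: S] o ->
  measurable_fun [set: S] (fun x => odflt (g x) (o x)).
Proof.
move=> mg mo.
rewrite (_ : (fun x => _) =
    (fun x => if isSome (o x) then odflt point (o x) else g x)).
  apply: measurable_fun_ifT => //; exact: measurableT_comp (measurable_oapp _ _) mo.
by apply/funext => x; case: (o x).
Qed.

End measurable_option.

Section measure_le_setring.
Context {d : measure_display} {T : measurableType d} {R : realType}.
Variables (mu nu : {finite_measure set T -> \bar R}) (k : R).
Local Notation le_on A := (mu A <= k%:E * nu A)%E.

Lemma measure_le_monotone : monotone [set A | measurable A /\ le_on A].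
Proof.
have le_lim (A : (set T)^nat) (B : set T) :
    mu \o A @ \oo --> mu B -> nu \o A @ \oo --> nu B ->
    (forall i, le_on (A i)) -> le_on B.
  move=> muAB nuAB leA.
  have knuAB : (fun i => k%:E * nu (A i))%E @ \oo --> (k%:E * nu B)%E.
    exact: cvgeZl.
  rewrite -(cvg_lim _ muAB)// -(cvg_lim _ knuAB)//.
  by apply: lee_lim; [exact: cvgP muAB|exact: cvgP knuAB|exact: nearW].
split=> A homoA MA.
- have mA : measurable (\bigcup_i A i).
    by apply: bigcupT_measurable => i; case: (MA i).
  split=> //; apply: (le_lim A) => [||i]; last by case: (MA i).
  + by apply: nondecreasing_cvg_mu => // i; case: (MA i).
  + by apply: nondecreasing_cvg_mu => // i; case: (MA i).
- have mA : measurable (\bigcap_i A i).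
    by apply: bigcapT_measurable => i; case: (MA i).
  have [mA0 _] := MA 0%N.
  split=> //; apply: (le_lim A) => [||i]; last by case: (MA i).
  + apply: nonincreasing_cvg_mu => // [|i]; last by case: (MA i).
    by rewrite ltey_eq fin_num_measure.
  + apply: nonincreasing_cvg_mu => // [|i]; last by case: (MA i).
    by rewrite ltey_eq fin_num_measure.
Qed.

Lemma measure_le_setring (G : set (set T)) : setring G -> G setT ->
  (forall A, G A -> measurable A /\ le_on A) ->
  forall A, <<s G >> A -> le_on A.
Proof.
move=> ringG GT leG A sA.
have := monotone_setring_sub_g_sigma_ring measure_le_monotone ringG leG.
have [G0 GD GU] := smallest_sigma_ring G.
move=> /(_ A)[]//; move: sA; apply: smallest_sub => /=; last exact: sub_g_sigma_ring.
by split=> // B sB; apply: GD => //; exact: sub_g_sigma_ring.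
Qed.

End measure_le_setring.

(** * Transcripts *)

Section transcripts.
Context {R : realType}.

Definition transcript_space := g_sigma_algebraType (@transcript_cylinders R).

HB.instance Definition _ := Measurable.on transcript_space.

Lemma transcript_cylinderE k (B : set R) :
  [set tau : transcript R | exists2 r, tau k = Some r & B r] =
  (fun tau => tau k) @^-1` (Some @` B).
Proof.
by apply/seteqP; split => tau /= [r]; [move=> -> Br|move=> Br <-]; exists r.
Qed.

Lemma measurable_to_transcript d (T : measurableType d) (Y : T -> transcript_space) :
  (forall k, measurable_fun [set: T] (fun x => Y x k)) -> measurable_fun [set: T] Y.
Proof.
move=> mY.
apply: (@measurability _ _ T transcript_space setT Y (@transcript_cylinders R)) => //.
move=> _ [_ [k [B [mB ->]]] <-]; rewrite transcript_cylinderE.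
by apply: mY => //; exact: measurable_image_some.
Qed.

Definition depends_below (K : nat) (S : set (transcript R)) : Prop :=
  forall tau tau', (forall k, (k < K)%N -> tau k = tau' k) -> S tau -> S tau'.

Definition finite_horizon : set (set transcript_space) :=
  
  [set S : set transcript_space | measurable S /\ exists K, depends_below K S].

Lemma setring_finite_horizon : setring finite_horizon.
Proof.
split.
- by split=> //; exists 0%N.
- move=> A B [mA [K AK]] [mB [L BL]]; split; first exact: measurableU.
  exists (maxn K L) => tau tau' tautau' [/AK|/BL] in_tau; [left|right];
    by apply: in_tau => k kK; apply: tautau'; rewrite leq_max kK ?orbT.
- move=> A B [mA [K AK]] [mB [L BL]]; split; first exact: measurableD.
  exists (maxn K L) => tau tau' tautau' [Atau nBtau]; split.
    by apply: AK Atau => k kK; apply: tautau'; rewrite leq_max kK.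
  by move=> /BL Btau; apply/nBtau/Btau => k kL; rewrite tautau'// leq_max kL orbT.
Qed.

Lemma transcript_measurable_sub_finite_horizon :
  @transcript_measurable R `<=` <<s finite_horizon >>.
Proof.
apply: sub_sigma_algebra2 => _ [k [B [mB ->]]]; split.
  by apply: sub_sigma_algebra; exists k, B.
by exists k.+1 => tau tau' tautau' /= [r]; rewrite tautau'//; exists r.
Qed.

Lemma transcript_distribution_le d (T : measurableType d) (P : probability T R)
    (Y Y' : {mfun T >-> transcript_space}) (k : R) :
  (forall K S, transcript_measurable S -> depends_below K S ->
     (P (Y @^-1` S) <= k%:E * P (Y' @^-1` S))%E) ->
  forall S, transcript_measurable S -> (P (Y @^-1` S) <= k%:E * P (Y' @^-1` S))%E.
Proof.
move=> le_horizon S /transcript_measurable_sub_finite_horizon.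
apply: (measure_le_setring (mu := distribution P Y) (nu := distribution P Y')).
- exact: setring_finite_horizon.
- by split; [exact: measurableT|exists 0%N].
- by move=> A [mA [K AK]]; split=> //; exact: le_horizon AK.
Qed.

End transcripts.

(** * Labelled executions *)

HB.instance Definition _ := gen_eqMixin draw.

(* The query is hard if g_1, g_2 or both are answered; PMWG then answers it or
   halts.  Whether g_2 is answered is not recorded when g_1 is answered and PMWG
   halts: keeping it the same for both databases would cost more than the privacy
   budget allows. *)
Inductive outcome :=
  Easy | FirstHard | SecondHard | BothHard | FirstHalt | SecondHalt.

Definition outcome_code (o : outcome) : nat :=
  match o with
  | Easy => 0 | FirstHard => 1 | SecondHard => 2
  | BothHard => 3 | FirstHalt => 4 | SecondHalt => 5
  end.

Definition outcome_decode : nat -> outcome :=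
  nth Easy [:: Easy; FirstHard; SecondHard; BothHard; FirstHalt; SecondHalt].

Lemma outcome_codeK : cancel outcome_code outcome_decode.
Proof. by case. Qed.

HB.instance Definition _ := Countable.copy outcome (can_type outcome_codeK).

(* [None] is the label of the steps after the end of the execution. *)
Definition label := option (nat * outcome).

Section run.
Context {R : realType} {N : nat}.
Variables (n : nat) (alpha : R) (xi : nat -> R) (F : query_strategy R N).
Local Notation state := (@pmwg_state R N).
Local Notation exhausted t H := (hard_query_bound (N := N) n alpha t < H.+1%:R).
Implicit Types (u : draw -> R) (f x y : 'rV[R]_N) (s : state).

Definition exceeds (t : nat) (eta nu v : R) : bool :=
  2 * alpha / 3 + eta / xi t <= v + nu.

(* Here [v] is the value g_1(x) = - g_2(x), and [ns] is the state of NSG on the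
   arrival of the query. *)

Definition first_eta u k (ns : option R) : R := odflt (u (Eta k false)) ns.

Definition first_fires u k t v ns : bool :=
  exceeds t (first_eta u k ns) (u (Nu t k false)) v.

Definition second_eta u k t v ns : R :=
  if first_fires u k t v ns then u (Eta k true) else first_eta u k ns.

Definition second_fires u k t v ns : bool :=
  exceeds t (second_eta u k t v ns) (u (Nu t k true)) (- v).

Definition nsg_after u k t v ns : option R :=
  if second_fires u k t v ns then None else Some (second_eta u k t v ns).

Definition outcome_of (first second halt : bool) : outcome :=
  match first, second, halt with
  | false, false, _ => Easy
  | true, false, false => FirstHard
  | false, true, false => SecondHard
  | true, true, false => BothHard
  | true, _, true => FirstHalt
  | false, true, true => SecondHalt
  end.

Definition query_outcome u k t v ns (halt : bool) : outcome :=
  outcome_of (first_fires u k t v ns) (second_fires u k t v ns) halt.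

Definition hard_answer u k t f x (o : outcome) : R :=
  if o is SecondHard then qeval f x - u (Zeta t k true)
  else qeval f x + u (Zeta t k false).

Definition query_result t f y (H : nat) (o : outcome) (a : R) (ns : option R) :
    option R * state :=
  match o with
  | Easy => (Some (qeval f y), PmwgState false (Some t) y H ns)
  | FirstHard | SecondHard | BothHard =>
      (Some a, PmwgState false (Some t)
        (mw_update alpha y (if a < qeval f y then f else const_mx 1 - f)) H.+1 ns)
  | FirstHalt | SecondHalt => (None, PmwgState true (Some t) y H.+1 ns)
  end.

Definition public t s : 'rV[R]_N := mix_uniform (st_last s) t (st_hist s).

Definition process_query u k t f x s : outcome * (option R * state) :=
  let y := public t s in
  let v := qeval f x - qeval f y in
  let o := query_outcome u k t v (st_nsg s) (exhausted t (st_hard s)) in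
  (o, query_result t f y (st_hard s) o (hard_answer u k t f x o)
        (nsg_after u k t v (st_nsg s))).

Arguments process_query : simpl never.

Lemma pmwg_queryE u k t f x s :
  pmwg_query n alpha xi u k t f x s = (process_query u k t f x s).2.
Proof.
rewrite /process_query /pmwg_query /nsg /natg /query_outcome /nsg_after /=.
rewrite /second_fires /second_eta /first_fires /exceeds /first_eta opprB.
rewrite -/(public t s).
set y := public t s.
have firstE z : qeval f y + (qeval f x - qeval f y + z) = qeval f x + z by ring.
have secondE z : qeval f y - (qeval f y - qeval f x + z) = qeval f x - z by ring.
case: (2 * alpha / 3 + _ <= _) => /=; case: (2 * alpha / 3 + _ <= _) => //=;
  by case: (hard_query_bound n alpha t < _) => //=; rewrite ?firstE ?secondE.
Qed.

Record run := Run {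
  run_hist : seq (option R);
  run_state : state;
  run_path : seq label
}.

Definition run_init := Run [::] pmwg_init [::].

Definition end_run s : state :=
  PmwgState true (st_last s) (st_hist s) (st_hard s) (st_nsg s).

Definition run_step (X : nat -> 'rV[R]_N) u (r : run) : run :=
  let: Run h s p := r in
  if st_done s then Run (rcons h None) s (rcons p None) else
  if F h is Some (t, f) then
    let: (o, (a, s')) := process_query u (size h) t f (X t) s in
    Run (rcons h a) s' (rcons p (Some (t, o)))
  else Run (rcons h None) (end_run s) (rcons p None).

Definition run_iter X u (k : nat) : run := iter k (run_step X u) run_init.

Lemma run_step_pmwg X u r :
  (run_hist (run_step X u r), run_state (run_step X u r)) =
  pmwg_step n alpha xi u F X (run_hist r, run_state r).
Proof.
case: r => h s p /=; case: ifP => // _; case: (F h) => [[t f]|]//.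
by rewrite pmwg_queryE /process_query/=; case: query_result.
Qed.

Lemma run_iter_pmwg X u k :
  (run_hist (run_iter X u k), run_state (run_iter X u k)) =
  iter k (pmwg_step n alpha xi u F X) ([::], pmwg_init).
Proof. by elim: k => [//|k IH]; rewrite /run_iter !iterS run_step_pmwg IH. Qed.

Lemma run_hist_step X u r : exists a,
  run_hist (run_step X u r) = rcons (run_hist r) a.
Proof.
case: r => h s p /=; case: ifP => _; first by eexists.
case: (F h) => [[t f]|]; last by eexists.
by rewrite /process_query; case: query_result => a s'; exists a.
Qed.

Lemma run_path_step X u r : exists l,
  run_path (run_step X u r) = rcons (run_path r) l.
Proof.
case: r => h s p /=; case: ifP => _; first by eexists.
case: (F h) => [[t f]|]; last by eexists.
by rewrite /process_query; case: query_result => a s'; eexists.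
Qed.

Lemma size_run_hist X u k : size (run_hist (run_iter X u k)) = k.
Proof.
elim: k => [//|k IH]; rewrite /run_iter iterS.
by have [a ->] := run_hist_step X u (run_iter X u k); rewrite size_rcons IH.
Qed.

Lemma size_run_path X u k : size (run_path (run_iter X u k)) = k.
Proof.
elim: k => [//|k IH]; rewrite /run_iter iterS.
by have [l ->] := run_path_step X u (run_iter X u k); rewrite size_rcons IH.
Qed.

Lemma take_run_path X u j k : (j <= k)%N ->
  take j (run_path (run_iter X u k)) = run_path (run_iter X u j).
Proof.
elim: k => [|k IH]; first by rewrite leqn0 => /eqP ->.
rewrite leq_eqVlt => /predU1P[->|jk].
  by rewrite take_oversize// size_run_path.
rewrite -IH// /run_iter iterS; have [l ->] := run_path_step X u (run_iter X u k).
by rewrite -cats1 takel_cat// size_run_path.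
Qed.

Lemma nth_run_hist X u k K : (k < K)%N ->
  nth None (run_hist (run_iter X u K)) k = pmwg n alpha xi u F X k.
Proof.
elim: K => [//|K IH]; rewrite ltnS leq_eqVlt => /predU1P[->|kK].
  by rewrite /pmwg -run_iter_pmwg.
rewrite -(IH kK) /run_iter iterS.
have [a ->] := run_hist_step X u (run_iter X u K).
by rewrite nth_rcons size_run_hist kK.
Qed.

Definition draw_index (e : draw) : nat :=
  match e with Eta k _ | Nu _ k _ | Zeta _ k _ => k end.

Lemma run_iter_draws X u v j :
  (forall e, (draw_index e < j)%N -> u e = v e) -> run_iter X u j = run_iter X v j.
Proof.
elim: j => [//|j IH] uv; rewrite /run_iter !iterS.
rewrite -/(run_iter X u j) -/(run_iter X v j).
rewrite -IH; last by move=> e ej; apply: uv; rewrite ltnS ltnW.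
have := size_run_hist X u j; case: (run_iter X u j) => h s p /= hj.
case: ifP => // _; case: (F h) => [[t f]|]//; rewrite hj.
rewrite /process_query /query_outcome /nsg_after /second_fires /second_eta.
by rewrite /first_fires /first_eta /hard_answer !uv.
Qed.

End run.

(** * Measurability of executions *)

Section measurable_run.
Context {R : realType} {N : nat}.
Local Notation run := (@run R N).
Implicit Types r : run.

Definition run_control r : nat * seq label * bool * option nat * nat :=
  (size (run_hist r), run_path r, st_done (run_state r), st_last (run_state r),
   st_hard (run_state r)).

Inductive run_event : set (set run) :=
| ControlEvent c : run_event [set r | run_control r = c]
| HistEvent k (A : set (option R)) of measurable A :
    run_event [set r | A (nth None (run_hist r) k)]
| PublicEvent j (B : set R) of measurable B :
    run_event [set r | B (st_hist (run_state r) ord0 j)]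
| NsgEvent (A : set (option R)) of measurable A :
    run_event [set r | A (st_nsg (run_state r))].

HB.instance Definition _ := gen_eqMixin run.
HB.instance Definition _ := gen_choiceMixin run.
HB.instance Definition _ := isPointed.Build run (@run_init R N).
HB.instance Definition _ := Measurable.copy run (g_sigma_algebraType run_event).

Lemma measurable_run_event (A : set run) : run_event A -> measurable A.
Proof. exact: sub_sigma_algebra. Qed.

Lemma measurable_run_hist k :
  measurable_fun [set: run] (fun r => nth None (run_hist r) k).
Proof.
by move=> _ A mA; rewrite setTI; apply: measurable_run_event; exact: HistEvent.
Qed.

Lemma measurable_run_public j :
  measurable_fun [set: run] (fun r => st_hist (run_state r) ord0 j).
Proof.
by move=> _ B mB; rewrite setTI; apply: measurable_run_event; exact: PublicEvent.
Qed.

Lemma measurable_run_nsg : measurable_fun [set: run] (fun r => st_nsg (run_state r)).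
Proof.
by move=> _ A mA; rewrite setTI; apply: measurable_run_event; exact: NsgEvent.
Qed.

Lemma measurable_run_control : measurable_fibers run_control.
Proof. by move=> c; apply: measurable_run_event; exact: ControlEvent. Qed.

Lemma measurable_run_path : measurable_fibers (@run_path R N).
Proof.
by apply: measurable_fibers_comp (fun c => c.1.1.1.2) measurable_run_control.
Qed.

Lemma measurable_run_size : measurable_fibers (fun r => size (run_hist r)).
Proof.
by apply: measurable_fibers_comp (fun c => c.1.1.1.1) measurable_run_control.
Qed.

Lemma measurable_run_transcript :
  measurable_fun [set: run] (fun r => nth None (run_hist r) : transcript_space).
Proof. by apply: measurable_to_transcript => k; exact: measurable_run_hist. Qed.

Lemma measurable_to_run d (T : measurableType d) (phi : T -> run) :
  measurable_fibers (run_control \o phi) ->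
  (forall k, measurable_fun [set: T] (fun x => nth None (run_hist (phi x)) k)) ->
  (forall j, measurable_fun [set: T] (fun x => st_hist (run_state (phi x)) ord0 j)) ->
  measurable_fun [set: T] (fun x => st_nsg (run_state (phi x))) ->
  measurable_fun [set: T] phi.
Proof.
move=> mcontrol mhist mpublic mnsg.
apply: (@measurability _ _ T run setT phi run_event) => //.
move=> _ [_ [c|k A mA|j B mB|A mA] <-].
- by rewrite setTI; exact: mcontrol.
- exact: mhist.
- exact: mpublic.
- exact: mnsg.
Qed.

End measurable_run.

Section measurable_step.
Context {R : realType} {N : nat}.
Variables (n : nat) (alpha : R) (xi : nat -> R) (F : query_strategy R N).
Hypothesis N_gt0 : (0 < N)%N.
Hypothesis F_stream : is_query_stream n F.
Local Notation run := (@run R N).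

Lemma measurable_inv : measurable_fun [set: R] (fun z : R => z^-1).
Proof.
rewrite (_ : (fun z => z^-1) = (fun z => z * (z ^+ 2) `^ (-1))).
  apply: measurable_funM => //.
  exact: measurableT_comp (measurable_powR (-1)) (exprn_measurable 2).
apply/funext => z; rewrite powR_inv1 ?sqr_ge0//.
by have [->|z0] := eqVneq z 0; [rewrite invr0 mul0r|field].
Qed.

Lemma measurable_query_event (A : nat -> set R) i : (forall t, measurable (A t)) ->
  measurable [set r : run |
    exists t f, F (run_hist r) = Some (t, f) /\ A t (f ord0 i)].
Proof.
move=> mA; have [_ _ _ _ F_measurable] := F_stream.
rewrite (_ : [set r | _] = \bigcup_t [set r | exists2 f,
    F (run_hist r) = Some (t, f) & A t (f ord0 i)]); last first.
  by apply/seteqP; split => r /= => [[t [f []]]|[t _ [f]]]; exists t => //; exists f.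
apply: bigcup_measurable => t _.
pose B k : set run := (fun r => nth None (run_hist r)) @^-1`
  [set tau : transcript R |
    exists2 f, F (mkseq tau k) = Some (t, f) & A t (f ord0 i)].
rewrite (_ : [set r | _] = [set r | B (size (run_hist r)) r]).
  apply: (measurable_selection measurable_run_size) => k.
  exact: measurable_preimage measurable_run_transcript (F_measurable _ _ _ _ (mA t)).
by apply/seteqP; split => r; rewrite /B /= mkseq_nth.
Qed.

Definition query_time (r : run) : option nat := omap fst (F (run_hist r)).

Definition query_vector (r : run) : 'rV[R]_N := oapp snd 0 (F (run_hist r)).

Lemma measurable_query_time : measurable_fibers query_time.
Proof.
have mtime t : measurable (query_time @^-1` [set Some t]).
  rewrite (_ : _ @^-1` _ = [set r | exists t' f, F (run_hist r) = Some (t', f) /\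
      [set _ : R | t' = t] (f ord0 (Ordinal N_gt0))]).
    apply: (measurable_query_event (A := fun t' => [set _ : R | t' = t])) => t'.
    exact: measurable_prop.
  apply/seteqP; split => r /=; rewrite /query_time.
    by case: (F _) => [[t' f]|]//= [->]; exists t, f.
  by move=> [t' [f [-> ->]]].
case=> [t|]; first exact: mtime.
rewrite (_ : _ @^-1` _ = ~` \bigcup_t query_time @^-1` [set Some t]).
  by apply: measurableC; exact: bigcup_measurable.
apply/seteqP; split => r /=; first by move=> Fr [t _] /=; rewrite Fr.
by case Fr: (query_time r) => [t|]// []; exists t.
Qed.

Lemma measurable_query_vector j :
  measurable_fun [set: run] (fun r => query_vector r ord0 j).
Proof.
move=> _ B mB; rewrite setTI.
pose answered : set run :=
  [set r | exists t f, F (run_hist r) = Some (t, f) /\ B (f ord0 j)].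
rewrite (_ : _ @^-1` _ =
    [set r | (if query_time r is Some _ then answered else [set _ | B 0]) r]).
  apply: (measurable_selection (A := fun ot =>
    if ot is Some _ then answered else [set _ | B 0]) measurable_query_time) => -[t|].
    by apply: (measurable_query_event (A := fun=> B)).
  exact: measurable_prop.
apply/seteqP; split => r /=; rewrite /query_time /query_vector /answered;
  case Fr: (F (run_hist r)) => [[t f]|]; rewrite /= ?mxE//.
- by exists t, f.
- by move=> [t' [f' []]]; rewrite Fr => -[_ <-].
Qed.

Context {d : measure_display} {T : measurableType d}.
Local Notation mfun g := (measurable_fun [set: T] g).
Local Notation mrow g := (forall j, mfun (fun x => g x ord0 j)).

Lemma measurable_qeval (f y : T -> 'rV[R]_N) :
  mrow f -> mrow y -> mfun (fun x => qeval (f x) (y x)).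
Proof. by move=> mf my; apply: measurable_sum => j; exact: measurable_funM. Qed.

Lemma measurable_mw_update (y r : T -> 'rV[R]_N) :
  mrow y -> mrow r -> mrow (fun x => mw_update alpha (y x) (r x)).
Proof.
move=> my mr j; rewrite /mw_update.
have mweight i : mfun (fun x => y x ord0 i * expR (- alpha * r x ord0 i / 6)).
  apply: measurable_funM => //; apply: measurableT_comp => //.
  by apply: measurable_funM => //; exact: measurable_funM.
apply: (eq_measurable_fun (fun x => y x ord0 j * expR (- alpha * r x ord0 j / 6) /
    \sum_i y x ord0 i * expR (- alpha * r x ord0 i / 6))).
  by move=> x _; rewrite mxE.
apply: measurable_funM => //; apply: (measurableT_comp measurable_inv).
exact: measurable_sum.
Qed.

Lemma measurable_mix_uniform l t (y : T -> 'rV[R]_N) :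
  mrow y -> mrow (fun x => mix_uniform l t (y x)).
Proof.
move=> my j; rewrite /mix_uniform; case: l => [t'|]//; case: (t' < t)%N => //.
apply: (eq_measurable_fun (fun x => t'%:R / t%:R * y x ord0 j +
    (t - t')%:R / t%:R * N%:R^-1)); first by move=> x _; rewrite mxE.
by apply: measurable_funD => //; exact: measurable_funM.
Qed.

Lemma measurable_penalty (b : bool) (f : T -> 'rV[R]_N) :
  mrow f -> mrow (fun x => if b then f x else const_mx 1 - f x).
Proof.
move=> mf j; case: b => //.
apply: (eq_measurable_fun (fun x => 1 - f x ord0 j)); last exact: measurable_funB.
by move=> x _; rewrite !mxE.
Qed.

Variable phi : T -> run.
Hypothesis measurable_phi : mfun phi.

Lemma measurable_nth_rcons (a : T -> option R) i : mfun a ->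
  mfun (fun x => nth None (rcons (run_hist (phi x)) (a x)) i).
Proof.
move=> ma; pose entry k x :=
  if (i < k)%N then nth None (run_hist (phi x)) i else if i == k then a x else None.
apply: (eq_measurable_fun (fun x => entry (size (run_hist (phi x))) x)).
  by move=> x _ /=; rewrite nth_rcons.
apply: measurable_fun_selection => [|k].
  exact: measurable_fibers_precomp measurable_phi measurable_run_size.
rewrite /entry; case: (i < k)%N; last by case: (i == k).
exact: measurableT_comp (measurable_run_hist i) measurable_phi.
Qed.

Lemma measurable_run_rcons done last H (a ns : T -> option R) (y : T -> 'rV[R]_N)
    (l : label) :
  mfun a -> mrow y -> mfun ns ->
  mfun (fun x => Run (rcons (run_hist (phi x)) (a x))
    (PmwgState done last (y x) H (ns x)) (rcons (run_path (phi x)) l)).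
Proof.
move=> ma my mns; apply: measurable_to_run => //; last first.
  by move=> k; exact: measurable_nth_rcons.
rewrite (_ : _ \o _ = (fun c => (c.1.1.1.1.+1, rcons c.1.1.1.2 l, done, last, H)) \o
    (run_control \o phi)).
  apply: measurable_fibers_comp.
  exact: measurable_fibers_precomp measurable_phi measurable_run_control.
by apply/funext => x; rewrite /= /run_control/= size_rcons.
Qed.

Lemma measurable_query_result t H (f y : T -> 'rV[R]_N) (o : T -> outcome)
    (a : T -> R) (ns : T -> option R) :
  mrow f -> mrow y -> measurable_fibers o -> mfun a -> mfun ns ->
  mfun (fun x =>
    let: (b, s) := query_result alpha t (f x) (y x) H (o x) (a x) (ns x) in
    Run (rcons (run_hist (phi x)) b) s (rcons (run_path (phi x)) (Some (t, o x)))).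
Proof.
move=> mf my mo ma mns.
have mqy : mfun (fun x => qeval (f x) (y x)) by exact: measurable_qeval.
have mlow : mfun (fun x => a x < qeval (f x) (y x)) by exact: measurable_fun_ltr.
have msome (g : T -> R) : mfun g -> mfun (Some \o g).
  by move=> mg; exact: measurableT_comp measurable_some mg.
pose result (c : outcome * bool) (x : T) : option R * @pmwg_state R N :=
  match c.1 with
  | Easy => (Some (qeval (f x) (y x)), PmwgState false (Some t) (y x) H (ns x))
  | FirstHard | SecondHard | BothHard =>
      (Some (a x), PmwgState false (Some t)
        (mw_update alpha (y x) (if c.2 then f x else const_mx 1 - f x)) H.+1 (ns x))
  | FirstHalt | SecondHalt => (None, PmwgState true (Some t) (y x) H.+1 (ns x))
  end.
apply: (measurable_fun_selection (f := fun x => (o x, a x < qeval (f x) (y x)))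
  (g := fun c x => let: (b, s) := result c x in
    Run (rcons (run_hist (phi x)) b) s (rcons (run_path (phi x)) (Some (t, c.1))))).
  by apply: measurable_fibers_pair => //; exact: measurable_fibers_bool.
have mupdate b :
    mrow (fun x => mw_update alpha (y x) (if b then f x else const_mx 1 - f x)).
  by apply: measurable_mw_update => //; exact: measurable_penalty.
by case=> -[] b /=; apply: measurable_run_rcons => //; exact: msome.
Qed.

Variable u : T -> draw -> R.
Hypothesis measurable_u : forall e, mfun (fun x => u x e).

Section measurable_query.
Variables (k t : nat) (v : T -> R) (ns : T -> option R).
Hypotheses (mv : mfun v) (mns : mfun ns).
Local Notation firsts x := (first_fires alpha xi (u x) k t (v x) (ns x)).
Local Notation seconds x := (second_fires alpha xi (u x) k t (v x) (ns x)).

Lemma measurable_exceeds (eta nu w : T -> R) : mfun eta -> mfun nu -> mfun w ->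
  mfun (fun x => exceeds alpha xi t (eta x) (nu x) (w x)).
Proof.
move=> meta mnu mw; apply: measurable_fun_ler; apply: measurable_funD => //.
exact: measurable_funM.
Qed.

Lemma measurable_first_eta : mfun (fun x => first_eta (u x) k (ns x)).
Proof. exact: measurable_odflt. Qed.

Lemma measurable_first_fires : mfun (fun x => firsts x).
Proof. by apply: measurable_exceeds => //; exact: measurable_first_eta. Qed.

Lemma measurable_second_eta :
  mfun (fun x => second_eta alpha xi (u x) k t (v x) (ns x)).
Proof.
apply: measurable_fun_ifT => //; first exact: measurable_first_fires.
exact: measurable_first_eta.
Qed.

Lemma measurable_second_fires : mfun (fun x => seconds x).
Proof.
apply: measurable_exceeds => //; first exact: measurable_second_eta.
exact: measurable_funN.
Qed.

Lemma measurable_nsg_after :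
  mfun (fun x => nsg_after alpha xi (u x) k t (v x) (ns x)).
Proof.
apply: measurable_fun_ifT => //; first exact: measurable_second_fires.
exact: measurableT_comp measurable_some measurable_second_eta.
Qed.

Lemma measurable_query_outcome halt :
  measurable_fibers (fun x => query_outcome alpha xi (u x) k t (v x) (ns x) halt).
Proof.
apply: (measurable_fibers_comp (fun b => outcome_of b.1 b.2 halt)
  (f := fun x => (firsts x, seconds x))).
by apply: measurable_fibers_pair; apply: measurable_fibers_bool;
  [exact: measurable_first_fires|exact: measurable_second_fires].
Qed.

End measurable_query.

Lemma measurable_hard_answer k t (f : T -> 'rV[R]_N) (z : 'rV[R]_N)
    (o : T -> outcome) :
  mrow f -> measurable_fibers o ->
  mfun (fun x => hard_answer (u x) k t (f x) z (o x)).
Proof.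
move=> mf mo; have mfz : mfun (fun x => qeval (f x) z) by exact: measurable_qeval.
apply: (measurable_fun_selection
  (g := fun c x => hard_answer (u x) k t (f x) z c)) => //.
by case; first [exact: measurable_funD|exact: measurable_funB].
Qed.

Lemma measurable_run_step X :
  mfun (fun x => run_step n alpha xi F X (u x) (phi x)).
Proof.
pose hist x := st_hist (run_state (phi x)); pose nsg x := st_nsg (run_state (phi x)).
pose query x := query_vector (phi x).
pose extend x b s l : run := Run (rcons (run_hist (phi x)) b) s
  (rcons (run_path (phi x)) l).
pose step (c : nat * seq label * bool * option nat * nat * option nat) x :=
  let: (k, _, done, last, H, time) := c in
  if done then extend x None (PmwgState true last (hist x) H (nsg x)) None
  else if time is Some t then
    let s := PmwgState false last (hist x) H (nsg x) in
    let: (o, (b, s')) := process_query n alpha xi (u x) k t (query x) (X t) s in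
    extend x b s' (Some (t, o))
  else extend x None (PmwgState true last (hist x) H (nsg x)) None.
apply: (eq_measurable_fun (fun x =>
  step (run_control (phi x), query_time (phi x)) x)).
  move=> x _; rewrite /step /extend /query /hist /nsg /query_time /query_vector.
  case: (phi x) => h [done last y H ns] p; rewrite /run_step /run_control/=.
  by case: done => //; case: (F h) => [[t f]|].
have mhist : mrow hist.
  by move=> j; exact: measurableT_comp (measurable_run_public j) measurable_phi.
have mnsg : mfun nsg by exact: measurableT_comp measurable_run_nsg measurable_phi.
have mquery : mrow query.
  by move=> j; exact: measurableT_comp (measurable_query_vector j) measurable_phi.
apply: measurable_fun_selection.
  apply: measurable_fibers_pair; apply: (measurable_fibers_precomp measurable_phi).
  - exact: measurable_run_control.
  - exact: measurable_query_time.
move=> [[[[[k p] []] last] H] [t|]]; try exact: measurable_run_rcons.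
have mpublic : mrow (fun x => mix_uniform last t (hist x)).
  exact: measurable_mix_uniform.
have mgap : mfun (fun x => qeval (query x) (X t) -
    qeval (query x) (mix_uniform last t (hist x))).
  by apply: measurable_funB; exact: measurable_qeval.
rewrite /step /process_query /public/=; set halt := (_ < _).
have moutcome := measurable_query_outcome k t mgap mnsg halt.
apply: measurable_query_result => //; first exact: measurable_hard_answer.
exact: measurable_nsg_after.
Qed.

End measurable_step.

Section measurable_iter.
Context {R : realType} {N : nat}.
Variables (n : nat) (alpha : R) (xi : nat -> R) (F : query_strategy R N).
Hypotheses (N_gt0 : (0 < N)%N) (F_stream : is_query_stream n F).
Local Notation noise_space := (@noise_space R draw).

Lemma measurable_run_iter X k :
  measurable_fun [set: noise_space] (fun u => run_iter n alpha xi F X u k).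
Proof.
elim: k => [|k IH]; first exact: measurable_cst.
by apply: measurable_run_step => // e; exact: measurable_coord.
Qed.

Lemma measurable_pmwg X : measurable_fun [set: noise_space]
  (fun u => pmwg n alpha xi u F X : @transcript_space R).
Proof.
apply: measurable_to_transcript => k.
apply: (eq_measurable_fun (fun u : noise_space =>
    nth None (run_hist (run_iter n alpha xi F X u k.+1)) k)).
  by move=> u _; rewrite nth_run_hist.
exact: measurableT_comp (measurable_run_hist k) (measurable_run_iter X k.+1).
Qed.

End measurable_iter.

(** * Shifts of the draws of one query *)

Section draw_shift.
Context {R : realType}.
Variables (n : nat) (xi : nat -> R).
Local Notation s t := (xi t / t%:R).

(* [last_hard] is [n] before the first hard query, and [natg_start] is the starting
   time of the running NATG instance, if any. *)
Record progress := Progress {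
  hard_count : nat;
  last_hard : nat;
  natg_start : option nat
}.

Definition progress_init := Progress 0 n None.

Definition next_start (start : option nat) (t : nat) (o : outcome) : option nat :=
  match o with
  | Easy => Some (odflt t start)
  | FirstHard => Some t
  | _ => None
  end.

Definition progress_step (g : progress) (l : label) : progress :=
  if l is Some (t, o) then
    let start := next_start (natg_start g) t o in
    if o is Easy then Progress (hard_count g) (last_hard g) start
    else Progress (hard_count g).+1 t start
  else g.

Definition progress_of (p : seq label) : progress :=
  foldl progress_step progress_init p.

Lemma progress_of_rcons p l :
  progress_of (rcons p l) = progress_step (progress_of p) l.
Proof. exact: foldl_rcons. Qed.

Definition eta_shift (start : option nat) : R := oapp (fun t => s t) 0 start.

(* [start] is the starting time of the running NATG instance, if any, and [del] is
   the difference of the values of the query on the two databases. *)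
Definition draw_shift (start : option nat) (t : nat) (o : outcome) (del : R)
    (e : draw) : R :=
  let raise := s (odflt t start) / xi t in
  match e with
  | Eta _ false => if start is Some _ then 0 else s t
  | Eta _ true => if o is FirstHard then s t else 0
  | Nu _ _ false =>
      if o is (FirstHard | BothHard | FirstHalt) then raise + Num.max 0 (- del) else 0
  | Nu _ _ true =>
      match o with
      | SecondHard | SecondHalt => raise + Num.max 0 del
      | BothHard => Num.max 0 del
      | _ => 0
      end
  | Zeta _ _ false => if o is (FirstHard | BothHard) then - del else 0
  | Zeta _ _ true => if o is SecondHard then del else 0
  end.

Definition label_cost (start : option nat) (t : nat) (o : outcome) : R :=
  (if start is Some _ then 0 else s t / 2) +
  match o with
  | Easy => 0
  | FirstHard => s (odflt t start) / 4 + 3 / 8 * s t + s t / 2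
  | SecondHard | BothHard => s (odflt t start) / 4 + 3 / 8 * s t
  | FirstHalt | SecondHalt => s (odflt t start) / 4 + s t / 4
  end.

Definition step_draws (k t : nat) : seq draw :=
  [:: Eta k false; Eta k true; Nu t k false; Nu t k true;
      Zeta t k false; Zeta t k true].

Lemma uniq_step_draws k t : uniq (step_draws k t).
Proof.
pose kind e := match e with
  | Eta _ b => (0%N, b) | Nu _ _ b => (1%N, b) | Zeta _ _ b => (2%N, b) end.
exact: (@map_uniq _ _ kind).
Qed.

Lemma max0D_norm (a : R) : Num.max 0 (- a) + Num.max 0 a = `|a|.
Proof.
have [a0|/ltW a0] := leP 0 a; last by rewrite max_r ?oppr_ge0// ler0_norm// addr0.
by rewrite max_l ?oppr_le0// ger0_norm// add0r.
Qed.

Lemma draw_shift_cost start k t o del : 0 < xi t ->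
  s t <= s (odflt t start) -> `|del| <= t%:R^-1 ->
  \sum_(e <- step_draws k t) `|draw_shift start t o del e| / draw_scale xi e <=
  label_cost start t o.
Proof.
move=> xi0 st_le del_le; rewrite !big_cons big_nil /= /label_cost.
have st0 : 0 <= s t by rewrite divr_ge0// ltW.
have sg0 := le_trans st0 st_le.
set sg := s (odflt t start) in sg0 st_le *.
set up := Num.max 0 (- del); set down := Num.max 0 del.
have up_ge0 : 0 <= up by rewrite le_max lexx.
have down_ge0 : 0 <= down by rewrite le_max lexx.
have nuE x : x / (4 / xi t) = x * xi t / 4 by field; rewrite gt_eqF.
have zetaE x : x / (8 / xi t) = x * xi t / 8 by field; rewrite gt_eqF.
have raiseE m : (sg / xi t + m) * xi t = sg + m * xi t by field; rewrite gt_eqF.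
have norm_raise m : 0 <= m -> `|sg / xi t + m| = sg / xi t + m.
  by move=> m0; rewrite ger0_norm// addr_ge0// divr_ge0// ltW.
have up_xi : 0 <= up * xi t by rewrite mulr_ge0// ltW.
have down_xi : 0 <= down * xi t by rewrite mulr_ge0// ltW.
have del_xi : `|del| * xi t <= s t by rewrite mulrC ler_pM2l.
have updown : up * xi t + down * xi t = `|del| * xi t by rewrite -mulrDl max0D_norm.
have norm_st : `|s t| = s t by rewrite ger0_norm.
have norm_down : `|down| = down by rewrite ger0_norm.
by case: start @sg st_le sg0 raiseE norm_raise => [t'|] sg st_le sg0 raiseE norm_raise;
  case: o;
  rewrite !nuE !zetaE ?normr0 ?normrN ?norm_raise ?raiseE ?norm_st ?norm_down//; lra.
Qed.

End draw_shift.

Section couple_query.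
Context {R : realType}.
Variables (alpha : R) (xi : nat -> R).
Local Notation s t := (xi t / t%:R).

Lemma exceeds_shift t eta nu v a del : `|del| <= a / xi t ->
  let b := exceeds alpha xi t eta nu v in
  exceeds alpha xi t (eta + a)
    (nu + if b then a / xi t + Num.max 0 (- del) else 0) (v + del) = b.
Proof.
move=> /ler_normlP[del_ge del_le] b.
have max_ge : - del <= Num.max 0 (- del) by rewrite le_max lexx orbT.
have etaE : (eta + a) / xi t = eta / xi t + a / xi t by rewrite mulrDl.
have [|] := boolP b; rewrite /b /exceeds etaE; first by move=> above; lra.
by rewrite -ltNge => below; apply/negbTE; rewrite -ltNge; lra.
Qed.

Lemma exceeds_le t eta nu v nu' v' : v + nu <= v' + nu' ->
  exceeds alpha xi t eta nu v -> exceeds alpha xi t eta nu' v'.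
Proof. by move=> le_vnu above; exact: le_trans le_vnu. Qed.

Variables (k t : nat) (start : option nat) (ns : option R) (u w : draw -> R).
Variables (v del : R) (halt : bool).
Hypotheses (xi0 : 0 < xi t) (st_le : s t <= s (odflt t start)).
Hypotheses (del_le : `|del| <= t%:R^-1) (start_ns : isSome start = isSome ns).
Local Notation o := (query_outcome alpha xi u k t v ns halt).
Local Notation g1_fires := (first_fires alpha xi u k t v ns).
Local Notation g2_fires := (second_fires alpha xi u k t v ns).
Local Notation ns' := (omap (fun z => z + eta_shift xi start) ns).
Hypothesis w_shift : forall e, e \in step_draws k t ->
  w e = u e + draw_shift xi start t o del e.

Let del_le_st : `|del| <= s t / xi t.
Proof. by rewrite mulrAC divff ?gt_eqF// mul1r. Qed.

Let del_le_start : `|del| <= s (odflt t start) / xi t.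
Proof. by rewrite (le_trans del_le_st)// ler_pM2r// invr_gt0. Qed.

Lemma first_eta_shift :
  first_eta w k ns' = first_eta u k ns + s (odflt t start).
Proof.
rewrite /first_eta w_shift ?mem_head//.
by case: start ns start_ns => [t'|] [z|].
Qed.

Lemma first_fires_shift : first_fires alpha xi w k t (v + del) ns' = g1_fires.
Proof.
rewrite -[RHS](exceeds_shift _ _ _ del_le_start) /first_fires first_eta_shift.
rewrite w_shift ?inE ?eqxx ?orbT//; congr exceeds; congr (_ + _).
rewrite /= /query_outcome /first_fires.
by case: (exceeds _ _ _ _ _ _) g2_fires halt => -[] [].
Qed.

Lemma second_eta_shift : ~~ (g1_fires && (g2_fires || halt)) ->
  second_eta alpha xi w k t (v + del) ns' =
  second_eta alpha xi u k t v ns + (if g1_fires then s t else s (odflt t start)).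
Proof.
rewrite /second_eta first_fires_shift first_eta_shift w_shift ?inE ?eqxx ?orbT//=.
by rewrite /query_outcome; case: g1_fires g2_fires halt => -[] [].
Qed.

Lemma second_fires_shift : ~~ (g1_fires && halt) ->
  second_fires alpha xi w k t (v + del) ns' = g2_fires.
Proof.
move=> nhalt; have [/andP[firstT secondT]|nboth] := boolP (g1_fires && g2_fires).
  have oE : o = BothHard.
    by rewrite /query_outcome firstT secondT; case: halt nhalt => //; rewrite firstT.
  have etaE : second_eta alpha xi w k t (v + del) ns' =
      second_eta alpha xi u k t v ns.
    rewrite /second_eta first_fires_shift firstT w_shift ?oE ?addr0//.
    by rewrite !inE eqxx !orbT.
  rewrite secondT; move: secondT; rewrite /second_fires etaE; apply: exceeds_le.
  rewrite w_shift ?inE ?eqxx ?orbT// oE opprD/=.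
  by have : del <= Num.max 0 del by [rewrite le_max lexx orbT]; lra.
pose a := if g1_fires then s t else s (odflt t start).
have del_le_a : `|- del| <= a / xi t by rewrite normrN /a; case: ifP.
rewrite -[RHS](exceeds_shift _ _ _ del_le_a).
rewrite /second_fires second_eta_shift; last first.
  by move: nboth nhalt; case: g1_fires g2_fires halt => -[] [].
rewrite opprD opprK -/a w_shift ?inE ?eqxx ?orbT//; congr exceeds; congr (_ + _).
rewrite /a /= /query_outcome -/g2_fires.
by move: nboth nhalt; case: g1_fires g2_fires halt => -[] [].
Qed.

Lemma query_outcome_shift : query_outcome alpha xi w k t (v + del) ns' halt = o.
Proof.
rewrite /query_outcome first_fires_shift.
have [/andP[-> ->]|nhalt] := boolP (g1_fires && halt).
  by case: second_fires g2_fires => -[].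
by rewrite second_fires_shift.
Qed.

Lemma nsg_after_shift : o \notin [:: FirstHalt; SecondHalt] ->
  nsg_after alpha xi w k t (v + del) ns' =
  omap (fun z => z + eta_shift xi (next_start start t o))
    (nsg_after alpha xi u k t v ns).
Proof.
move=> nhalt; have nfh : ~~ (g1_fires && halt).
  by move: nhalt; rewrite /query_outcome; case: g1_fires g2_fires halt => -[] [].
rewrite /nsg_after second_fires_shift//; case secondE : g2_fires => //=.
rewrite second_eta_shift ?secondE//; congr (Some (_ + _)).
by move: nhalt; rewrite /query_outcome secondE; case: g1_fires halt => -[].
Qed.

Lemma hard_answer_shift N (f x x' : 'rV[R]_N) :
  o \in [:: FirstHard; SecondHard; BothHard] -> qeval f x' = qeval f x + del ->
  hard_answer w k t f x' o = hard_answer u k t f x o.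
Proof.
move=> hard x'E; rewrite /hard_answer x'E !w_shift ?inE ?eqxx ?orbT//.
by case: o hard => //= _; ring.
Qed.

End couple_query.

(** * Coupled executions *)

Section coupled.
Context {R : realType} {N : nat}.
Variables (n : nat) (alpha : R) (xi : nat -> R) (F : query_strategy R N).
Local Notation s t := (xi t / t%:R).
Local Notation run := (@run R N).
Implicit Types (u w : draw -> R) (f x : 'rV[R]_N) (st : @pmwg_state R N) (r : run).

Definition raise_eta (c : R) st : pmwg_state :=
  PmwgState (st_done st) (st_last st) (st_hist st) (st_hard st)
    (omap (fun z => z + c) (st_nsg st)).

Definition coupled (c : R) r r' : Prop :=
  [/\ run_hist r = run_hist r', run_path r = run_path r',
      st_done (run_state r) = st_done (run_state r') &
      ~~ st_done (run_state r) -> run_state r' = raise_eta c (run_state r)].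

Lemma process_query_shift u w k t f x x' start st o a st1 :
  0 < xi t -> s t <= s (odflt t start) ->
  `|qeval f x' - qeval f x| <= t%:R^-1 -> isSome start = isSome (st_nsg st) ->
  process_query n alpha xi u k t f x st = (o, (a, st1)) ->
  (forall e, e \in step_draws k t ->
    w e = u e + draw_shift xi start t o (qeval f x' - qeval f x) e) ->
  exists st1', [/\
    process_query n alpha xi w k t f x' (raise_eta (eta_shift xi start) st) =
      (o, (a, st1')),
    st_done st1 = st_done st1' &
    ~~ st_done st1 -> st1' = raise_eta (eta_shift xi (next_start start t o)) st1].
Proof.
move=> xi0 st_le del_le start_ns; rewrite /process_query /public => -[].
set y := mix_uniform _ _ _; set v := qeval f x - qeval f y; set halt := (_ < _).
set del := qeval f x' - qeval f x => <- resE w_shift.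
have x'E : qeval f x' = qeval f x + del by rewrite addrC subrK.
have -> : qeval f x' - qeval f y = v + del by rewrite x'E addrAC.
have outcomeE := query_outcome_shift xi0 st_le del_le start_ns w_shift.
have nsgE := nsg_after_shift xi0 st_le del_le start_ns w_shift.
have answerE := hard_answer_shift w_shift _ x'E.
rewrite /= outcomeE in nsgE answerE *; move: resE nsgE answerE {outcomeE w_shift}.
by case: query_outcome => -[<- <-] nsgE answerE; rewrite /query_result ?answerE//;
  eexists; split=> //= _; rewrite /raise_eta -nsgE.
Qed.

Lemma run_step_label X u r l :
  run_path (run_step n alpha xi F X u r) = rcons (run_path r) l ->
  if l is Some (t, o) then
    ~~ st_done (run_state r) /\ exists f a st1, [/\ F (run_hist r) = Some (t, f),
      process_query n alpha xi u (size (run_hist r)) t f (X t) (run_state r) =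
        (o, (a, st1)) &
      run_step n alpha xi F X u r =
        Run (rcons (run_hist r) a) st1 (rcons (run_path r) l)]
  else (st_done (run_state r) \/ F (run_hist r) = None) /\
    st_done (run_state (run_step n alpha xi F X u r)).
Proof.
case: r => h st p; rewrite /run_step; case: ifP => [done /rcons_inj[<-]|_].
  by split; [left|].
rewrite [run_hist _]/=; case: (F h) => [[t f]|]; last first.
  by move=> /rcons_inj[<-]; split; [right|].
case queryE: (process_query n alpha xi u (size h) t f (X t) st) =>
  [oc [a st1]] /= /rcons_inj[<-].
by split => //; exists f, a, st1.
Qed.

Lemma coupled_run_step X X' u w r r' g l :
  run_path (run_step n alpha xi F X u r) = rcons (run_path r) l ->
  coupled (eta_shift xi (natg_start g)) r r' ->
  (forall t o f, l = Some (t, o) -> F (run_hist r) = Some (t, f) ->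
    [/\ 0 < xi t, s t <= s (odflt t (natg_start g)),
        `|qeval f (X' t) - qeval f (X t)| <= t%:R^-1,
        isSome (natg_start g) = isSome (st_nsg (run_state r)) &
        forall e, e \in step_draws (size (run_hist r)) t -> w e = u e +
          draw_shift xi (natg_start g) t o (qeval f (X' t) - qeval f (X t)) e]) ->
  coupled (eta_shift xi (natg_start (progress_step g l)))
    (run_step n alpha xi F X u r) (run_step n alpha xi F X' w r').
Proof.
move=> /run_step_label; case: r r' => h st p [h' st' p'] labelE.
move=> [hE pE doneE stE] query_shift.
rewrite /= in hE pE doneE stE; subst h' p'.
case: l labelE query_shift => [[t o]|] labelE query_shift; last first.
  move: labelE; rewrite /run_step -doneE; have [done|ndone] := boolP (st_done st).
    by move=> _; split=> //=; rewrite done.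
  by case=> -[//|->] _; split.
have [ndone [f [a [st1 [Fh queryE ->]]]]] := labelE.
have [xi0 st_le del_le start_ns w_shift] := query_shift _ _ _ erefl Fh.
have [st1' [queryE' done1E st1E]] :=
  process_query_shift xi0 st_le del_le start_ns queryE w_shift.
rewrite /= in ndone Fh queryE'.
rewrite /run_step -doneE (negbTE ndone) Fh stE// queryE'.
by split=> //= /st1E ->; case: (o).
Qed.

End coupled.

(** * Privacy cost of an execution *)

Section charge_budget.
Context {R : realDomainType}.
Variables (B s : nat -> R) (n : nat).
Hypothesis s_noninc : forall t t', (n <= t <= t')%N -> s t' <= s t.
Hypothesis B_nondec : forall t t', (n <= t <= t')%N -> B t <= B t'.

(* If at most [B t] events occur up to every time [t], then the sum of [s] over the
   times of the events up to [t] is at most [charge_budget t]. *)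
Definition charge_budget (t : nat) : R :=
  B n * s n + \sum_(n.+1 <= i < t.+1) (B i - B i.-1) * s i.

Lemma charge_budget_increase t t' : (n <= t)%N -> (t <= t')%N ->
  charge_budget t + (B t' - B t) * s t' <= charge_budget t'.
Proof.
move=> nt; elim: t' => [|t' IH].
  by rewrite leqn0 => /eqP ->; rewrite subrr mul0r addr0.
rewrite leq_eqVlt => /predU1P[->|tt']; first by rewrite subrr mul0r addr0.
have nt' := leq_trans nt tt'.
have -> : charge_budget t'.+1 = charge_budget t' + (B t'.+1 - B t') * s t'.+1.
  by rewrite /charge_budget big_nat_recr//= addrA.
have := IH tt'.
have : (B t' - B t) * s t'.+1 <= (B t' - B t) * s t'.
  by rewrite ler_wpM2l ?subr_ge0 ?B_nondec ?nt//; apply: s_noninc; rewrite nt' leqnSn.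
by lra.
Qed.

(* A bound on the sum of [s] over the first [H] events, the last of which occurs at
   time [m] (or [m = n] if [H = 0]). *)
Definition charge_bound (H m : nat) : R := charge_budget m - (B m - H%:R) * s m.

Lemma charge_bound0 : charge_bound 0 n = 0.
Proof. by rewrite /charge_bound /charge_budget big_geq// addr0 subr0 subrr. Qed.

Lemma charge_bound_next H m t : (n <= m <= t)%N -> H%:R <= B m ->
  charge_bound H m + s t <= charge_bound H.+1 t.
Proof.
move=> nmt HB; have /andP[nm mt] := nmt; rewrite /charge_bound -[H.+1%:R]natr1.
have := charge_budget_increase nm mt.
have : (B m - H%:R) * s t <= (B m - H%:R) * s m.
  by rewrite ler_wpM2l ?subr_ge0 ?s_noninc.
by lra.
Qed.

Lemma charge_bound_le H m : H%:R <= B m -> 0 <= s m ->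
  charge_bound H m <= charge_budget m.
Proof. by move=> HB s0; rewrite lerBlDr lerDl mulr_ge0 ?subr_ge0. Qed.

End charge_budget.

Section hard_query_bound.
Context {R : realType}.
Variables (N n : nat) (alpha : R).
Hypotheses (N_gt0 : (0 < N)%N) (n_gt0 : (0 < n)%N).
Local Notation bnd := (@hard_query_bound R N n alpha).

Lemma bt_ge0 t : (1 < t)%N -> 0 <= bt N t :> R.
Proof.
case: t => [//|[//|t]] _; rewrite /bt /= !addr_ge0//.
- by rewrite divr_ge0// ln_ge0// ler1n.
- by rewrite divr_ge0// ln_ge0// ler1n.
- by rewrite ln_ge0// ler_pdivlMr ?ltr0n// mul1r ler_nat.
Qed.

Lemma hard_query_bound_init : bnd n = 36 / alpha ^+ 2 * ln N%:R.
Proof. by rewrite /hard_query_bound big_geq// addr0. Qed.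

Lemma hard_query_bound_init_ge0 : 0 <= bnd n.
Proof.
by rewrite hard_query_bound_init mulr_ge0 ?divr_ge0 ?sqr_ge0// ln_ge0// ler1n.
Qed.

Lemma hard_query_boundS t : (n <= t)%N ->
  bnd t.+1 = bnd t + 36 / alpha ^+ 2 * bt N t.+1.
Proof. by move=> nt; rewrite /hard_query_bound big_nat_recr//= addrA mulrDr. Qed.

Lemma hard_query_bound_nondecreasing t t' : (n <= t <= t')%N -> bnd t <= bnd t'.
Proof.
case/andP=> nt; elim: t' => [|t' IH]; first by rewrite leqn0 => /eqP ->.
rewrite leq_eqVlt => /predU1P[->//|tt']; apply: (le_trans (IH tt')).
have nt' := leq_trans nt tt'.
rewrite hard_query_boundS// lerDl mulr_ge0 ?divr_ge0 ?sqr_ge0// bt_ge0// ltnS.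
exact: leq_trans nt'.
Qed.

End hard_query_bound.

Section path_cost.
Context {R : realType} {N : nat}.
Variables (n : nat) (alpha : R) (xi : nat -> R).
Local Notation s := (fun t => xi t / t%:R).
Local Notation bnd := (@hard_query_bound R N n alpha).
Local Notation progress_of := (progress_of n).

Definition step_cost (g : progress) (l : label) : R :=
  if l is Some (t, o) then label_cost xi (natg_start g) t o else 0.

Definition path_cost (p : seq label) : R :=
  \sum_(j < size p) step_cost (progress_of (take j p)) (nth None p j).

Lemma path_cost_rcons p l :
  path_cost (rcons p l) = path_cost p + step_cost (progress_of p) l.
Proof.
rewrite /path_cost size_rcons big_ord_recr/= nth_rcons ltnn eqxx.
rewrite -cats1 takel_cat// take_size; congr (_ + _); apply: eq_bigr => j _.
by rewrite takel_cat ?(ltnW (ltn_ord j))// nth_cat ltn_ord.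
Qed.

(* A lower bound on the starting time of the NATG instance that gets the next
   query. *)
Definition start_time (g : progress) : nat := odflt (last_hard g) (natg_start g).

Definition admissible (g : progress) : Prop :=
  (n <= last_hard g <= start_time g)%N /\ (hard_count g)%:R <= bnd (last_hard g).

(* A hard query at time t is charged 3/8 s_t for itself and, in advance, 3/4 s_t for
   the NATG instance that follows it, so that 3/4 s_(last_hard g) is still unspent;
   the last term is what the running instance has spent on eta. *)
Definition potential (g : progress) : R :=
  3 / 4 * (s n - s (last_hard g)) +
  9 / 8 * charge_bound bnd s n (hard_count g) (last_hard g) +
  oapp (fun t => s t / 2) 0 (natg_start g).

Hypotheses (N_gt0 : (0 < N)%N) (n_gt0 : (0 < n)%N).
Hypothesis xi_gt0 : forall t, (0 < t)%N -> 0 < xi t.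
Hypothesis s_noninc : forall t t', (0 < t)%N -> (t <= t')%N -> s t' <= s t.

Variable L : R.
Hypothesis budget_le : forall t, (n <= t)%N -> charge_budget bnd s n t <= L.

Lemma scaled_noise_ge0 t : (0 < t)%N -> 0 <= s t.
Proof. by move=> t0; rewrite divr_ge0// ltW// xi_gt0. Qed.

Lemma charge_bound_limit g : admissible g ->
  charge_bound bnd s n (hard_count g) (last_hard g) <= L.
Proof.
move=> [/andP[nm _] Hle]; apply: le_trans (budget_le nm).
by apply: charge_bound_le => //; apply: scaled_noise_ge0; exact: leq_trans nm.
Qed.

Lemma potential_limit g : admissible g -> potential g <= s n + 9 / 8 * L.
Proof.
move=> g_adm; have := charge_bound_limit g_adm.
have [/andP[nm ms] _] := g_adm; have m0 := leq_trans n_gt0 nm.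
have := scaled_noise_ge0 n_gt0; have := scaled_noise_ge0 m0; rewrite /potential.
move: ms; rewrite /start_time; case: (natg_start g) => [t|] /= ms; last by lra.
by have := s_noninc m0 ms; lra.
Qed.

Section query.
Variables (g : progress) (t : nat) (o : outcome).
Hypotheses (g_adm : admissible g) (start_le : (start_time g <= t)%N).
Local Notation m := (last_hard g).
Local Notation sg := (s (odflt t (natg_start g))).

Let nm : (n <= m)%N. Proof. by case: g_adm => /andP[]. Qed.

Let m0 : (0 < m)%N. Proof. exact: leq_trans nm. Qed.

Let mt : (m <= t)%N.
Proof. by case: g_adm => /andP[_ ms] _; exact: leq_trans start_le. Qed.

Let sg_le : sg <= s m.
Proof.
case: g_adm => /andP[_]; rewrite /start_time.
by case: (natg_start g) => [t'|] /= ? _; exact: s_noninc.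
Qed.

Lemma potential_eta : potential g + (if natg_start g is Some _ then 0 else s t / 2) =
  3 / 4 * (s n - s m) + 9 / 8 * charge_bound bnd s n (hard_count g) m + sg / 2.
Proof. by rewrite /potential; case: (natg_start g) => [t'|] /=; rewrite addr0. Qed.

Lemma potential_easy :
  potential g + label_cost xi (natg_start g) t Easy =
  potential (progress_step g (Some (t, Easy))).
Proof. by rewrite /label_cost addr0 potential_eta. Qed.

Lemma potential_hard : o \in [:: FirstHard; SecondHard; BothHard] ->
  potential g + label_cost xi (natg_start g) t o <=
  potential (progress_step g (Some (t, o))).
Proof.
have [_ hard_le] := g_adm.
have next : charge_bound bnd s n (hard_count g) m + s t <=
    charge_bound bnd s n (hard_count g).+1 t.
  apply: charge_bound_next => //; last by rewrite nm mt.
  - by move=> i i' /andP[ni ii']; apply: s_noninc => //; exact: leq_trans ni.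
  - exact: hard_query_bound_nondecreasing.
have := sg_le; rewrite /label_cost addrA potential_eta.
by case: o => //= sg_m _; rewrite /potential /=; lra.
Qed.

Lemma potential_halt : o \in [:: FirstHalt; SecondHalt] ->
  potential g + label_cost xi (natg_start g) t o <= s n + 9 / 8 * L.
Proof.
have st_n : s t <= s n by apply: s_noninc => //; exact: leq_trans mt.
have := charge_bound_limit g_adm; have := sg_le.
rewrite /label_cost addrA potential_eta.
by case: o => //= sg_m bound_L _; lra.
Qed.

Lemma admissible_step : (o == Easy) || ((hard_count g).+1%:R <= bnd t) ->
  admissible (progress_step g (Some (t, o))) /\
  (start_time (progress_step g (Some (t, o))) <= t)%N.
Proof.
have [/andP[_ ms] hard_le] := g_adm; rewrite /admissible /start_time.
move: ms start_le; rewrite /start_time; case: o => /= ms st hard;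
  rewrite ?nm ?(leq_trans nm mt) ?leqnn//.
by case: (natg_start g) ms st => [t'|] //=; rewrite mt leqnn.
Qed.

End query.

End path_cost.

Section run_cost.
Context {R : realType} {N : nat}.
Variables (n : nat) (alpha : R) (xi : nat -> R) (F : query_strategy R N).
Local Notation s := (fun t => xi t / t%:R).
Local Notation bnd := (@hard_query_bound R N n alpha).
Local Notation progress_of := (progress_of n).
Local Notation run_step := (run_step n alpha xi F).
Local Notation run_iter := (run_iter n alpha xi F).
Hypotheses (N_gt0 : (0 < N)%N) (n_gt0 : (0 < n)%N).
Hypothesis F_stream : is_query_stream n F.

Implicit Types (f x : 'rV[R]_N) (st : @pmwg_state R N).

Definition tracked (r : @run R N) : Prop :=
  let g := progress_of (run_path r) in
  [/\ admissible (N := N) n alpha g, hard_count g = st_hard (run_state r),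
      isSome (natg_start g) = isSome (st_nsg (run_state r)) &
      forall t f, F (run_hist r) = Some (t, f) -> (start_time g <= t)%N].

Lemma process_query_outcomeP u k t f x st o a st1 :
  process_query n alpha xi u k t f x st = (o, (a, st1)) ->
  if st_done st1 then (o \in [:: FirstHalt; SecondHalt] : Prop) else
  [/\ o \in [:: Easy; FirstHard; SecondHard; BothHard],
      st_hard st1 = if o is Easy then st_hard st else (st_hard st).+1,
      (o == Easy) || ((st_hard st).+1%:R <= bnd t) &
      forall start, isSome (next_start start t o) = isSome (st_nsg st1)].
Proof.
rewrite /process_query /nsg_after /query_outcome leNgt => -[<-].
by case: first_fires second_fires (bnd t < _) => -[] [] [_ <-].
Qed.

Lemma tracked_init : tracked run_init.
Proof.
have [F_start _ _ _ _] := F_stream.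
split=> //=; last by move=> t f; exact: F_start.
by split; rewrite ?leqnn//; exact: hard_query_bound_init_ge0.
Qed.

Lemma tracked_step X u r : tracked r -> ~~ st_done (run_state (run_step X u r)) ->
  tracked (run_step X u r).
Proof.
have [_ _ F_mono _ _] := F_stream; move=> [g_adm hardE _ F_start].
have [l pathE] := run_path_step n alpha xi F X u r.
have := run_step_label pathE; case: l pathE => [[t o]|] pathE; last by case=> _ ->.
move=> [_ [f [a [st1 [Fh queryE ->]]]]].
rewrite /tracked /= progress_of_rcons => /negbTE done1.
have start_le := F_start _ _ Fh.
have := process_query_outcomeP queryE; rewrite done1 -hardE.
move=> [_ hard1E within_bnd nsg1E].
have [g1_adm g1_start] := admissible_step g_adm start_le within_bnd.
split=> //.
- by rewrite hard1E; case: (o).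
- by rewrite -(nsg1E (natg_start (progress_of (run_path r)))); case: (o).
- by move=> t' f' /(F_mono _ _ _ _ _ _ Fh); exact: leq_trans.
Qed.

Lemma run_iter_tracked X u k :
  ~~ st_done (run_state (run_iter X u k)) -> tracked (run_iter X u k).
Proof.
elim: k => [_|k IH]; first exact: tracked_init.
rewrite /run_iter iterS -/(run_iter X u k) => ndone; apply: tracked_step => //.
apply: IH; apply: contra ndone; case: (run_iter X u k) => h st p /= done.
by rewrite /run_step done.
Qed.

Hypothesis xi_gt0 : forall t, (0 < t)%N -> 0 < xi t.
Hypothesis s_noninc : forall t t', (0 < t)%N -> (t <= t')%N -> s t' <= s t.
Variable L : R.
Hypothesis budget_le : forall t, (n <= t)%N -> charge_budget bnd s n t <= L.

Lemma path_cost_step X u r : tracked r ->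
  path_cost n xi (run_path r) <=
    potential (N := N) n alpha xi (progress_of (run_path r)) ->
  let r' := run_step X u r in
  path_cost n xi (run_path r') <= if st_done (run_state r') then s n + 9 / 8 * L
    else potential (N := N) n alpha xi (progress_of (run_path r')).
Proof.
move=> [g_adm _ _ F_start] cost_le.
have [l pathE] := run_path_step n alpha xi F X u r.
have := run_step_label pathE; rewrite /= pathE path_cost_rcons.
case: l pathE => [[t o]|] pathE; last first.
  by move=> [_ ->]; rewrite addr0 (le_trans cost_le)//; exact: potential_limit.
move=> [_ [f [a [st1 [Fh queryE ->]]]]] /=; rewrite progress_of_rcons.
have start_le := F_start _ _ Fh.
apply: (le_trans (lerD cost_le (lexx _))).
have := process_query_outcomeP queryE; case: ifP => [_ halt|_ [easy_or_hard _ _ _]].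
  exact: potential_halt.
move: easy_or_hard; rewrite inE => /predU1P[->|hard]; last exact: potential_hard.
by rewrite potential_easy.
Qed.

Lemma run_iter_cost X u k :
  path_cost n xi (run_path (run_iter X u k)) <= s n + 9 / 8 * L.
Proof.
suff : path_cost n xi (run_path (run_iter X u k)) <=
    if st_done (run_state (run_iter X u k)) then s n + 9 / 8 * L
    else potential (N := N) n alpha xi (progress_of (run_path (run_iter X u k))).
  case: ifP => // /negbT ndone /le_trans; apply.
  by have [g_adm _ _ _] := run_iter_tracked ndone; exact: potential_limit.
elim: k => [|k IH].
  by rewrite /path_cost big_ord0 /potential /= charge_bound0 !subrr !mulr0 !addr0.
rewrite /run_iter iterS -/(run_iter X u k).
have [done|ndone] := boolP (st_done (run_state (run_iter X u k))).
  move: IH; rewrite done; case: (run_iter X u k) done => h st p /= done.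
  by rewrite /run_step done /= done path_cost_rcons addr0.
rewrite (negbTE ndone) in IH; apply: path_cost_step => //.
exact: run_iter_tracked.
Qed.

End run_cost.

(** * Privacy for a general noise function *)

Section path_shift.
Context {R : realType} {N : nat}.
Variables (n : nat) (alpha : R) (xi : nat -> R) (F : query_strategy R N).
Variables X X' : nat -> 'rV[R]_N.
Local Notation noise_space := (@noise_space R draw).
Local Notation s := (fun t => xi t / t%:R).
Local Notation progress_of := (progress_of n).
Local Notation run_iter := (run_iter n alpha xi F).
Implicit Types (u : noise_space) (p : seq label).

Definition draws_at p (k : nat) : seq draw :=
  if nth None p k is Some (t, _) then step_draws k t else [::].

Definition path_draws p : seq draw :=
  flatten [seq draws_at p k | k <- iota 0 (size p)].

Lemma draw_index_draws_at p k e : e \in draws_at p k -> draw_index e = k.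
Proof.
rewrite /draws_at; case: nth => [[t o]|//].
by rewrite !inE => /or4P[| | |/or3P[]] /eqP ->.
Qed.

Lemma mem_path_draws p k e :
  (k < size p)%N -> e \in draws_at p k -> e \in path_draws p.
Proof. by move=> kp ek; apply/flatten_mapP; exists k; rewrite // mem_iota. Qed.

Lemma path_drawsP p e : e \in path_draws p ->
  exists t o, nth None p (draw_index e) = Some (t, o) /\
    e \in step_draws (draw_index e) t.
Proof.
case/flatten_mapP=> k _ ek; rewrite (draw_index_draws_at ek).
by move: ek; rewrite /draws_at; case: nth => [[t o]|//]; exists t, o.
Qed.

Lemma pairwise_path_draws (r : rel draw) p :
  (forall k, pairwise r (draws_at p k)) ->
  (forall e e', (draw_index e < draw_index e')%N -> r e e') ->
  pairwise r (path_draws p).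
Proof.
move=> r_at r_lt; rewrite /path_draws; elim: (size p) 0%N => [//|K IH] k /=.
rewrite pairwise_cat r_at IH !andbT.
apply/allrelP => e e' ek /flatten_mapP[k' kk' ek'].
apply: r_lt; rewrite (draw_index_draws_at ek) (draw_index_draws_at ek').
by move: kk'; rewrite mem_iota => /andP[].
Qed.

Lemma uniq_path_draws p : uniq (path_draws p).
Proof.
rewrite uniq_pairwise; apply: pairwise_path_draws => [k|e e' ee'].
  rewrite -uniq_pairwise /draws_at; case: nth => [[t o]|//].
  exact: uniq_step_draws.
by apply: contraTneq ee' => ->; rewrite ltnn.
Qed.

Lemma sorted_path_draws p : sorted (relpre draw_index leq) (path_draws p).
Proof.
apply/pairwise_sorted/pairwise_path_draws => [k|e e' /ltnW//].
by rewrite /draws_at; case: nth => [[t o]|//]; rewrite /= !leqnn.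
Qed.

Definition path_shift p u (e : draw) : R :=
  let k := draw_index e in
  match nth None p k, F (run_hist (run_iter X u k)) with
  | Some (t, o), Some (_, f) =>
      draw_shift xi (natg_start (progress_of (take k p))) t o
        (qeval f (X' t) - qeval f (X t)) e
  | _, _ => 0
  end.

Lemma predictable_path_shift p : predictable (path_draws p) (path_shift p).
Proof.
apply: (@predictable_rank _ _ draw_index); first exact: sorted_path_draws.
by move=> u v e uv; rewrite /path_shift (run_iter_draws _ _ _ _ _ uv).
Qed.

Definition shift_path p u : noise_space :=
  shift_coords (path_draws p) (path_shift p u) u.

Hypotheses (N_gt0 : (0 < N)%N) (n_gt0 : (0 < n)%N).
Hypothesis F_stream : is_query_stream n F.
Hypothesis xi_gt0 : forall t, (0 < t)%N -> 0 < xi t.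
Hypothesis s_noninc : forall t t', (0 < t)%N -> (t <= t')%N -> s t' <= s t.
Hypothesis sensitivity : forall t f, (n <= t)%N -> is_linear_query f ->
  `|qeval f (X' t) - qeval f (X t)| <= t%:R^-1.

Section fixed_path.
Variables (p : seq label) (u : noise_space).
Hypothesis path_u : run_path (run_iter X u (size p)) = p.

Lemma run_iter_path k : (k <= size p)%N -> run_path (run_iter X u k) = take k p.
Proof. by move=> kp; rewrite -[in RHS]path_u take_run_path. Qed.

Lemma run_iter_label k : (k < size p)%N ->
  run_path (run_step n alpha xi F X u (run_iter X u k)) =
  rcons (run_path (run_iter X u k)) (nth None p k).
Proof.
move=> kp; rewrite run_iter_path; last exact: ltnW.
by rewrite -take_nth// -run_iter_path// /run_iter iterS.
Qed.

Lemma path_query k t o : (k < size p)%N -> nth None p k = Some (t, o) ->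
  let start := natg_start (progress_of (take k p)) in
  exists f, [/\ F (run_hist (run_iter X u k)) = Some (t, f), 0 < xi t,
    s t <= s (odflt t start),
    `|qeval f (X' t) - qeval f (X t)| <= t%:R^-1 &
    isSome start = isSome (st_nsg (run_state (run_iter X u k)))].
Proof.
move=> kp lab start; have := run_step_label (run_iter_label kp); rewrite lab.
case=> ndone [f [_ [_ [Fh _ _]]]]; exists f.
have [[/andP[nm ms] _] _ nsgE F_start] := run_iter_tracked N_gt0 F_stream ndone.
have [Fn Flin _ _ _] := F_stream; have nt := Fn _ _ _ Fh.
move: nm ms nsgE (F_start _ _ Fh); rewrite /start_time run_iter_path ?(ltnW kp)//.
rewrite -/start => nm ms nsgE st; have t0 := leq_trans n_gt0 nt.
have start_gt0 : (0 < odflt t start)%N.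
  by case: start ms {nsgE st} => //= t'; exact/leq_trans/leq_trans/nm.
split=> //.
- exact: xi_gt0.
- by apply: s_noninc => //; case: start st {ms nsgE start_gt0}.
- by apply: sensitivity => //; exact: Flin Fh.
Qed.

Lemma path_shift_cost :
  \sum_(e <- path_draws p) `|path_shift p u e| / draw_scale xi e <= path_cost n xi p.
Proof.
rewrite /path_draws big_flatten big_map /path_cost -(big_mkord xpredT
  (fun k => step_cost xi (progress_of (take k p)) (nth None p k))).
rewrite /index_iota subn0 !big_seq; apply: ler_sum => k; rewrite mem_iota /= => kp.
rewrite big_seq.
under eq_bigr => e ek do rewrite /path_shift (draw_index_draws_at ek).
rewrite -big_seq /draws_at.
case lab: (nth None p k) => [[t o]|]; last by rewrite big_nil.
have [f [-> xi0 st_le del_le _]] := path_query kp lab.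
exact: draw_shift_cost.
Qed.

Lemma coupled_run_iter k : (k <= size p)%N ->
  coupled (eta_shift xi (natg_start (progress_of (take k p))))
    (run_iter X u k) (run_iter X' (shift_path p u) k).
Proof.
elim: k => [_|k IH kp]; first by rewrite take0.
rewrite (take_nth None kp) progress_of_rcons /run_iter !iterS.
apply: coupled_run_step (run_iter_label kp) (IH (ltnW kp)) _ => t o f lab Fh.
have [f' [Fh' xi0 st_le del_le nsgE]] := path_query kp lab.
move: Fh'; rewrite Fh => -[?]; subst f'; split=> // e; rewrite size_run_hist => ek.
have ep : e \in draws_at p k by rewrite /draws_at lab.
by rewrite /shift_path /shift_coords (mem_path_draws kp ep) /path_shift
  (draw_index_draws_at ep) lab Fh.
Qed.

End fixed_path.

Context {d : measure_display} {Omega : measurableType d}.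
Variables (P : probability Omega R) (W : draw -> {RV P >-> R}).
Hypothesis W_noise : is_laplace_noise n xi W.

Definition path_event Y p (A : set (transcript R)) : set noise_space :=
  [set u | run_path (run_iter Y u (size p)) = p /\
           A (nth None (run_hist (run_iter Y u (size p))))].

Lemma measurable_path_event Y p A :
  transcript_measurable A -> measurable (path_event Y p A).
Proof.
move=> mA; have mrun := measurable_run_iter alpha xi N_gt0 F_stream Y (size p).
apply: (@measurableI _ _ ((fun u => run_path (run_iter Y u (size p))) @^-1` [set p])).
  exact: measurable_fibers_precomp mrun measurable_run_path p.
exact: measurable_preimage (measurableT_comp measurable_run_transcript mrun) mA.
Qed.

Lemma path_event_le p A : transcript_measurable A -> path_event X p A !=set0 ->
  (law W (path_event X p A) <=
   (expR (path_cost n xi p))%:E * law W (path_event X' p A))%E.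
Proof.
move=> mA [u0 [path_u0 _]]; have [indepW laplaceW] := W_noise.
apply: (law_le_shift (b := draw_scale xi) indepW (uniq_path_draws p) _ _ _
  (predictable_path_shift p)).
- move=> e /path_drawsP[t [oc [lab est]]].
  have kp : (draw_index e < size p)%N.
    by rewrite ltnNge; apply/negP => /(nth_default None); rewrite lab.
  have [f [Fh xi0 _ _ _]] := path_query path_u0 kp lab.
  have [Fn _ _ _ _] := F_stream; have nt := Fn _ _ _ Fh.
  split; last apply: laplaceW;
    move: est; rewrite !inE => /or4P[| | |/or3P[]] /eqP -> //=; by rewrite divr_gt0.
- exact: measurable_path_event.
- exact: measurable_path_event.
- by move=> u [path_u _]; exact: path_shift_cost.
- move=> u [path_u Au].
  have [histE pathE _ _] := coupled_run_iter path_u (leqnn (size p)).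
  by rewrite /path_event /= -pathE -histE.
Qed.

Variable L : R.
Hypothesis budget_le : forall t, (n <= t)%N ->
  charge_budget (hard_query_bound (N := N) n alpha) s n t <= L.

Lemma finite_horizon_le K (A : set (transcript R)) :
  transcript_measurable A -> depends_below K A ->
  (law W [set u | A (pmwg n alpha xi u F X)] <=
   (expR (s n + 9 / 8 * L))%:E * law W [set u | A (pmwg n alpha xi u F X')])%E.
Proof.
move=> mA AK.
have mY Y : measurable [set u : noise_space | A (pmwg n alpha xi u F Y)].
  exact: measurable_preimage (measurable_pmwg alpha xi N_gt0 F_stream Y) mA.
have mpath Y : measurable_fibers (fun u : noise_space => run_path (run_iter Y u K)).
  exact: measurable_fibers_precomp (measurable_run_iter alpha xi N_gt0 F_stream Y K)
    measurable_run_path.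
apply: (measure_le_fibers (expR_ge0 _) (mY X) (mY X') (mpath X) (mpath X')).
move=> p path0; have [u0 [/= pathE _]] := path0.
have pK : size p = K by rewrite -pathE size_run_path.
have path_eventE Y : (fun u => run_path (run_iter Y u K)) @^-1` [set p] `&`
    [set u | A (pmwg n alpha xi u F Y)] = path_event Y p A.
  have histE u k : (k < K)%N ->
      nth None (run_hist (run_iter Y u K)) k = pmwg n alpha xi u F Y k.
    exact: nth_run_hist.
  rewrite /path_event pK; apply/seteqP.
  by split => u /= [? Au]; split=> //; apply: AK Au => k kK; rewrite histE.
rewrite path_eventE in path0; rewrite !path_eventE.
apply: (le_trans (path_event_le mA path0)); apply: lee_wpmul2r => //.
rewrite lee_fin ler_expR -pathE.
exact: run_iter_cost.
Qed.

End path_shift.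

Section sensitivity.
Context {R : realType} {N : nat}.
Implicit Types f x y : 'rV[R]_N.

Lemma qevalD f x y : qeval f (x + y) = qeval f x + qeval f y.
Proof. by rewrite -big_split; apply: eq_bigr => i _; rewrite mxE mulrDr. Qed.

Lemma qevalZ f (c : R) x : qeval f (c *: x) = c * qeval f x.
Proof. by rewrite mulr_sumr; apply: eq_bigr => i _; rewrite mxE mulrCA. Qed.

Lemma qeval_delta f i : qeval f (delta_mx ord0 i) = f ord0 i.
Proof.
rewrite /qeval (bigD1 i)//= mxE !eqxx mulr1 big1 ?addr0// => j ji.
by rewrite mxE (negbTE ji) andbF mulr0.
Qed.

Lemma neighboring_streams_sensitivity n (X X' : nat -> 'rV[R]_N) t f :
  neighboring_streams n X X' -> (n <= t)%N -> is_linear_query f ->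
  `|qeval f (X' t) - qeval f (X t)| <= t%:R^-1.
Proof.
move=> [t0 [_ before after]] nt lf; have [tt0|t0t] := ltnP t t0.
  by rewrite before ?nt// subrr normr0 invr_ge0.
have [_ _ [i [j [_ ->]]]] := after _ t0t.
rewrite -scaleNr !qevalD !qevalZ !qeval_delta.
have -> : qeval f (X t) + - t%:R^-1 * f ord0 i + t%:R^-1 * f ord0 j - qeval f (X t)
    = t%:R^-1 * (f ord0 j - f ord0 i) by ring.
rewrite normrM ger0_norm ?invr_ge0// ler_piMr ?invr_ge0// ler_norml.
by have := lf i; have := lf j; lra.
Qed.

End sensitivity.

Lemma pmwg_private (R : realType) (N n : nat) (alpha : R) (xi : nat -> R)
    (F : query_strategy R N) (L : R) (d : measure_display)
    (Omega : measurableType d) (P : probability Omega R) (W : draw -> {RV P >-> R}) :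
  (0 < N)%N -> (0 < n)%N ->
  (forall t, (0 < t)%N -> 0 < xi t) ->
  (forall t t', (0 < t)%N -> (t <= t')%N -> xi t' / t'%:R <= xi t / t%:R) ->
  (forall t, (n <= t)%N ->
    charge_budget (hard_query_bound (N := N) n alpha)
      (fun t => xi t / t%:R) n t <= L) ->
  is_laplace_noise n xi W -> is_query_stream n F ->
  differentially_private n P (fun X w => pmwg n alpha xi (fun e => W e w) F X)
    (xi n / n%:R + 9 / 8 * L).
Proof.
move=> N0 n0 xi0 s_noninc budget_le W_noise F_stream X X' _ _ XX'.
pose Y Z : {mfun @noise_space R draw >-> @transcript_space R} :=
  HB.pack (fun u => pmwg n alpha xi u F Z)
    (isMeasurableFun.Build _ _ _ _ _ (measurable_pmwg alpha xi N0 F_stream Z)).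
have horizon K S (mS : transcript_measurable S) (SK : depends_below K S) :=
  finite_horizon_le N0 n0 F_stream xi0 s_noninc
    (fun t f => neighboring_streams_sensitivity XX') W_noise budget_le mS SK.
exact: (transcript_distribution_le (P := law W) (Y := Y X) (Y' := Y X') horizon).
Qed.

(** * The budget for the noise of PMWG *)

(* [b ^+ 4 - a ^+ 4 = 1] gives [b - a >= (4 * b ^+ 3)^-1]. *)
Lemma inv_exp5_le_telescope (R : realFieldType) (a b : R) :
  0 < a -> a <= b -> b ^+ 4 = a ^+ 4 + 1 -> (b ^+ 5)^-1 <= 4 * (a^-1 - b^-1).
Proof.
move=> a0 ab ab4; have b0 : 0 < b := lt_le_trans a0 ab.
have diff_ge : 1 <= (b - a) * (4 * b ^+ 3).
  have diffE : (b - a) * ((b + a) * (b ^+ 2 + a ^+ 2)) = 1.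
    by transitivity (b ^+ 4 - a ^+ 4); [ring|rewrite ab4 addrAC subrr add0r].
  have -> : 4 * b ^+ 3 = (b + b) * (b ^+ 2 + b ^+ 2) by ring.
  rewrite -[leLHS]diffE; apply: ler_wpM2l; first by rewrite subr_ge0.
  by apply: ler_pM; rewrite ?addr_ge0 ?sqr_ge0 ?lerD2l ?lerXn2r ?nnegrE// ltW.
have -> : a^-1 - b^-1 = (b - a) / (a * b) by field; rewrite !gt_eqF.
rewrite mulrA ler_pdivlMr ?mulr_gt0// mulrC ler_pdivrMr ?exprn_gt0//.
have -> : 4 * (b - a) * b ^+ 5 = (b - a) * (4 * b ^+ 3) * (b * b) by ring.
apply: (@le_trans _ _ (b * b)); first by rewrite ler_wpM2r// ltW.
by rewrite ler_peMl// mulr_ge0 ?ltW.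
Qed.

Section fourth_root.
Context {R : realType}.

Definition root4 (t : nat) : R := Num.sqrt (Num.sqrt t%:R).

Lemma root4_gt0 t : (0 < t)%N -> 0 < root4 t.
Proof. by move=> t0; rewrite !sqrtr_gt0 ltr0n. Qed.

Lemma root4_sqr t : root4 t ^+ 2 = Num.sqrt t%:R.
Proof. by rewrite sqr_sqrtr// sqrtr_ge0. Qed.

Lemma root4_exp4 t : root4 t ^+ 4 = t%:R.
Proof. by rewrite (exprM _ 2 2) root4_sqr sqr_sqrtr. Qed.

Lemma root4_ge1 t : (0 < t)%N -> 1 <= root4 t.
Proof.
by move=> t0; rewrite -(@expr_ge1 _ 4)// ?root4_exp4 ?ler1n// ltW// root4_gt0.
Qed.

Lemma le_root4 t t' : (t <= t')%N -> root4 t <= root4 t'.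
Proof. by move=> tt'; rewrite ler_wsqrtr// ler_wsqrtr// ler_nat. Qed.

Lemma root4_telescope t : (0 < t)%N ->
  (root4 t.+1 ^+ 5)^-1 <= 4 * ((root4 t)^-1 - (root4 t.+1)^-1).
Proof.
move=> t0; apply: inv_exp5_le_telescope; first exact: root4_gt0.
  exact: le_root4.
by rewrite !root4_exp4 -natr1.
Qed.

Lemma ln_le_root4 t : (0 < t)%N -> ln t%:R <= 4 * root4 t.
Proof.
move=> t0; rewrite -[t%:R]root4_exp4 lnXn ?root4_gt0// -[leLHS]mulr_natl ler_pM2l//.
exact/ltW/ln_sublinear/root4_gt0.
Qed.

Lemma ln_ratio_le t : (0 < t)%N -> ln (t.+1%:R / t%:R) <= 2 / t.+1%:R :> R.
Proof.
move=> t0; have tR : 0 < t%:R :> R by rewrite ltr0n.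
apply: (@le_trans _ _ t%:R^-1).
  have -> : t.+1%:R / t%:R = 1 + t%:R^-1 :> R.
    by rewrite -natr1 mulrDl mul1r divff ?gt_eqF// addrC.
  by apply: le_ln1Dx; rewrite (lt_trans (ltrN10 _))// invr_gt0.
rewrite ler_pdivlMr ?ltr0n// mulrC ler_pdivrMr// -natrM ler_nat.
by rewrite mul2n -addnn -addn1 leq_add2l.
Qed.

Lemma bt_le_root4 N t : (0 < N)%N -> (0 < t)%N ->
  bt N t.+1 <= (ln N%:R + 6) * root4 t.+1 / t.+1%:R :> R.
Proof.
move=> N0 t0; have root1 := root4_ge1 (ltn0Sn t).
have lnN : 0 <= ln N%:R :> R by rewrite ln_ge0// ler1n.
have ln_t : ln t%:R <= 4 * root4 t.+1.
  apply: le_trans (ln_le_root4 (ltn0Sn t)).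
  by rewrite ler_ln ?posrE ?ltr0n// ler_nat.
have -> : (ln N%:R + 6) * root4 t.+1 / t.+1%:R =
    ln N%:R * root4 t.+1 / t.+1%:R + 4 * root4 t.+1 / t.+1%:R +
    2 * root4 t.+1 / t.+1%:R.
  by ring.
rewrite /bt /=; apply: lerD; first apply: lerD.
- by rewrite ler_pM2r ?invr_gt0 ?ltr0n// ler_peMr.
- by rewrite ler_pM2r ?invr_gt0 ?ltr0n.
- apply: (le_trans (ln_ratio_le t0)); rewrite ler_pM2r ?invr_gt0 ?ltr0n//.
  by rewrite ler_peMr.
Qed.

End fourth_root.

Lemma sum_le_telescope (R : numDomainType) (u v : nat -> R) (n m : nat) :
  (n <= m)%N ->
  (forall t, (n <= t < m)%N -> u t.+1 <= v t - v t.+1) ->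
  \sum_(n.+1 <= t < m.+1) u t <= v n - v m.
Proof.
move=> nm u_le; rewrite big_add1 /= -[leRHS]opprB -(telescope_sumr v nm) -sumrN.
by apply: ler_sum_nat => t /u_le; rewrite opprB.
Qed.

Section sqrt_noise.
Context {R : realType}.
Variables (N n : nat) (c : R).
Hypotheses (N_gt0 : (0 < N)%N) (n_gt0 : (0 < n)%N) (c_gt0 : 0 < c).
Local Notation s := (fun t : nat => c * Num.sqrt t%:R / t%:R).

Lemma sqrt_noiseE t : (0 < t)%N -> s t = c / root4 t ^+ 2.
Proof.
move=> t0; rewrite /= -root4_sqr -[X in _ / X = _]root4_exp4.
by field; rewrite gt_eqF// root4_gt0.
Qed.

Lemma sqrt_noise_nonincreasing t t' : (0 < t)%N -> (t <= t')%N -> s t' <= s t.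
Proof.
move=> t0 tt'; have t'0 := leq_trans t0 tt'.
rewrite !sqrt_noiseE// ler_pM2l// lef_pV2 ?posrE ?exprn_gt0 ?root4_gt0//.
by rewrite !root4_sqr ler_wsqrtr// ler_nat.
Qed.

Lemma bt_sqrt_noise_le t : (0 < t)%N ->
  bt N t.+1 * s t.+1 <= c * (ln N%:R + 6) * 4 * (root4 t)^-1 -
                        c * (ln N%:R + 6) * 4 * (root4 t.+1)^-1.
Proof.
move=> t0; have root0 := @root4_gt0 R _ (ltn0Sn t).
have lnN : 0 <= ln N%:R :> R by rewrite ln_ge0// ler1n.
rewrite sqrt_noiseE//.
apply: (@le_trans _ _ (c * (ln N%:R + 6) * (root4 t.+1 ^+ 5)^-1)).
  apply: le_trans (ler_wpM2r _ (bt_le_root4 N_gt0 t0)) _.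
    by rewrite divr_ge0 ?sqr_ge0// ltW.
  rewrite -(root4_exp4 t.+1) le_eqVlt; apply/orP; left; apply/eqP.
  by field; rewrite gt_eqF.
rewrite -mulrBr -[leRHS]mulrA; apply: ler_wpM2l; last exact: root4_telescope.
by rewrite mulr_ge0 ?addr_ge0// ltW.
Qed.

Definition bt_charges (m : nat) : R := \sum_(n.+1 <= t < m) bt N t * s t.

Lemma bt_charges_nondecreasing : nondecreasing_seq bt_charges.
Proof.
apply/nondecreasing_seqP => m; rewrite /bt_charges.
have [mn|nm] := leqP m n; first by rewrite !big_geq// ltnW.
rewrite big_nat_recr//= lerDl mulr_ge0//.
  by apply: bt_ge0 => //; exact: leq_ltn_trans n_gt0 nm.
by rewrite divr_ge0// mulr_ge0 ?sqrtr_ge0// ltW.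
Qed.

Lemma bt_charges_bounded : has_ubound (range bt_charges).
Proof.
pose v (t : nat) : R := c * (ln N%:R + 6) * 4 * (root4 t)^-1.
have v_ge0 t : 0 <= v t.
  by rewrite !mulr_ge0 ?addr_ge0 ?invr_ge0 ?sqrtr_ge0// ?ln_ge0 ?ler1n// ltW.
exists (v n) => _ [m _ <-]; rewrite /bt_charges.
case: m => [|m]; first by rewrite big_geq.
have [nm|mn] := leqP n m; last by rewrite big_geq// ltnW.
apply: (@le_trans _ _ (v n - v m)); last by rewrite lerBlDr lerDl.
apply: sum_le_telescope => // t /andP[nt _]; apply: bt_sqrt_noise_le.
exact: leq_trans nt.
Qed.

Lemma bt_charges_le_limn m : bt_charges m <= limn bt_charges.
Proof.
apply: nondecreasing_cvgn_le; first exact: bt_charges_nondecreasing.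
apply: nondecreasing_is_cvgn; first exact: bt_charges_nondecreasing.
exact: bt_charges_bounded.
Qed.

Lemma charge_budget_le_limn alpha t : (n <= t)%N ->
  charge_budget (hard_query_bound (N := N) n alpha) s n t <=
  36 / alpha ^+ 2 * (ln N%:R * s n + limn bt_charges).
Proof.
move=> nt; rewrite /charge_budget hard_query_bound_init [leRHS]mulrDr.
rewrite [X in _ <= X + _]mulrA lerD2l.
apply: (@le_trans _ _ (36 / alpha ^+ 2 * bt_charges t.+1)); last first.
  by rewrite ler_wpM2l ?divr_ge0 ?sqr_ge0// bt_charges_le_limn.
rewrite /bt_charges mulr_sumr !big_nat; apply: ler_sum => -[//|i] /andP[ni _].
by rewrite hard_query_boundS//= addrAC subrr add0r -[leLHS]mulrA.
Qed.

End sqrt_noise.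

Theorem theorem23 (R : realType) (N n : nat) (eps0 alpha : R)
    (d : measure_display) (Omega : measurableType d) (P : probability Omega R)
    (W : draw -> {RV P >-> R}) (F : query_strategy R N)
    (hNn : (1 < N * n)%N) (heps0 : 0 < eps0) (halpha : 0 < alpha) :
  let xi := pmwg_noise N n alpha eps0 in
  let Delta (t : nat) : R := t%:R^-1 in
  is_laplace_noise n xi W ->
  is_query_stream n F ->
  differentially_private n P
    (fun X w => pmwg n alpha xi (fun e => W e w) F X)
    ((1 + 81 / (2 * alpha ^+ 2) * ln N%:R) * (xi n * Delta n) +
     81 / (2 * alpha ^+ 2) *
       limn (fun m => \sum_(n.+1 <= t < m) bt N t * (xi t * Delta t))).
Proof.
move=> xi Delta W_noise F_stream.
have [N0 n0] : (0 < N)%N /\ (0 < n)%N by apply/andP; rewrite -muln_gt0 ltnW.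
pose c := alpha ^+ 2 * Num.sqrt n%:R / (162 * ln (N * n)%:R) * eps0.
have c0 : 0 < c.
  rewrite mulr_gt0// divr_gt0 ?mulr_gt0 ?exprn_gt0 ?sqrtr_gt0 ?ltr0n//.
  by rewrite ln_gt0// ltr1n.
pose L := 36 / alpha ^+ 2 * (ln N%:R * (xi n / n%:R) + limn (bt_charges N n c)).
have -> : (1 + 81 / (2 * alpha ^+ 2) * ln N%:R) * (xi n * Delta n) +
     81 / (2 * alpha ^+ 2) * limn (bt_charges N n c) = xi n / n%:R + 9 / 8 * L.
  by rewrite /L /Delta; field; rewrite pnatr_eq0 -lt0n n0 gt_eqF.
apply: pmwg_private => //.
- by move=> t t0; rewrite mulr_gt0// sqrtr_gt0 ltr0n.
- exact: sqrt_noise_nonincreasing.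
- exact: charge_budget_le_limn.
Qed.
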